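(* For every $s\in\mathbb N$ and $\boldsymbol\mu=(\mu^1,\mu^2)\in\mathcal P(\mathcal X)\times\mathcal P(\mathcal X)$, there exists a continuous map $$[\boldsymbol\varphi^{\boldsymbol\mu}]'':\overline{\mathcal M_{\mu^1}}^{\ell^\infty(B^s)}\times\overline{\mathcal M_{\mu^2}}^{\ell^\infty(B^s)}\to\mathcal C(\mathcal X)\times\mathcal C(\mathcal X)$$ such that for every family $(\boldsymbol\mu_t)_{t>0}\subset\mathcal P_{\mu^1}\times\mathcal P_{\mu^2}$ with $\boldsymbol\gamma_t:=t^{-1}(\boldsymbol\mu_t-\boldsymbol\mu)\to\boldsymbol\gamma$ in $\ell^\infty(B^s)\times\ell^\infty(B^s)$ as $t\downarrow0$, we have $$\frac{\boldsymbol\varphi^{\boldsymbol\mu_t}-\boldsymbol\varphi^{\boldsymbol\mu}-t[\boldsymbol\varphi^{\boldsymbol\mu}]'(\boldsymbol\gamma_t)}{t^2/2}\to[\boldsymbol\varphi^{\boldsymbol\mu}]''(\boldsymbol\gamma)\quad\text{in }\mathcal C(\mathcal X)\times\mathcal C(\mathcal X).$$ The map $[\boldsymbol\varphi^{\boldsymbol\mu}]''$ is positively homogeneous of degree $2$, i.e. $[\boldsymbol\varphi^{\boldsymbol\mu}]''(t\boldsymbol\gamma)=t^2[\boldsymbol\varphi^{\boldsymbol\mu}]''(\boldsymbol\gamma)$ for every $t>0$ and $\boldsymbol\gamma\in\overline{\mathcal M_{\mu^1}}^{\ell^\infty(B^s)}\times\overline{\mathcal M_{\mu^2}}^{\ell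^\infty(B^s)}$.
   Context: Fix $d\in\mathbb N$, $\varepsilon>0$, a smooth (infinitely differentiable) symmetric cost function $c:\mathbb R^d\times\mathbb R^d\to[0,\infty)$, and a bounded closed ball $\mathcal X\subset\mathbb R^d$. $\mathcal P(\mathcal X)$ is the set of Borel probability measures on $\mathcal X$. Fix a reference point $(x_1^\circ,x_2^\circ)\in\mathcal X\times\mathcal X$. EOT potentials: for $\boldsymbol\mu=(\mu^1,\mu^2)\in\mathcal P(\mathcal X)\times\mathcal P(\mathcal X)$, $\boldsymbol\varphi^{\boldsymbol\mu}=(\varphi_1^{\boldsymbol\mu},\varphi_2^{\boldsymbol\mu})$ denotes the unique pair in $\mathcal C(\mathcal X)\times\mathcal C(\mathcal X)$ such that $\int e^{(\varphi_1(x_1)+\varphi_2(x_2)-c(x_1,x_2))/\varepsilon}\,d\mu^2(x_2)=1$ for all $x_1\in\mathcal X$, $\int e^{(\varphi_1(x_1)+\varphi_2(x_2)-c(x_1,x_2))/\varepsilon}\,d\mu^1(x_1)=1$ for all $x_2\in\mathcal X$, and $\varphi_1(x_1^\circ)=\varphi_2(x_2^\circ)$. These functions belong to $\mathcal C^s(\mathcal X)$ for every $s$. Function spaces: $\mathcal C^s(\mathcal X)$ is the Banach space of functions on $\mathcal X$ having continuous derivatives of all orders $\le s$ on $\mathrm{int}(\mathcal X)$ that extend continuously to $\mathcal X$, with norm $\|f\|_{\mathcal C^s(\mathcal X)}=\sum_{j=0}^s\max_{|k|=j}\|D^kf\|_{\infty,\mathrm{int}(\mathcal X)}$; $B^s=\{f\in\mathcal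 C^s(\mathcal X):\|f\|_{\mathcal C^s(\mathcal X)}\le1\}$; $\ell^\infty(B^s)$ is the space of bounded real functions on $B^s$ with the sup-norm. A finite signed Borel measure $\gamma$ on $\mathcal X$ is identified with the element $f\mapsto\int f\,d\gamma$ of $\ell^\infty(B^s)$. Products carry product norms. For $\eta\in\mathcal P(\mathcal X)$: $\mathcal P_\eta=\{\nu\in\mathcal P(\mathcal X):\mathrm{spt}(\nu)\subset\mathrm{spt}(\eta)\}$ and $\mathcal M_\eta=\{t(\nu-\eta):\nu\in\mathcal P_\eta,\ t>0\}$. $\overline{A}^{\ell^\infty(B^s)}$ is the closure of $A$ in $\ell^\infty(B^s)$. First derivative: the map $\boldsymbol\nu\mapsto\boldsymbol\varphi^{\boldsymbol\nu}$, $\mathcal P_{\mu^1}\times\mathcal P_{\mu^2}\subset\ell^\infty(B^s)\times\ell^\infty(B^s)\to\mathcal C^s(\mathcal X)\times\mathcal C^s(\mathcal X)$, is Hadamard differentiable at $\boldsymbol\mu$ tangentially to $\overline{\mathcal M_{\mu^1}}^{\ell^\infty(B^s)}\times\overline{\mathcal M_{\mu^2}}^{\ell^\infty(B^s)}$, and $[\boldsymbol\varphi^{\boldsymbol\mu}]'$ denotes its derivative there: the continuous linear map (i.e. admitting a linear extension to the linear hull of its domain) such that $t^{-1}(\boldsymbol\varphi^{\boldsymbol\mu_t}-\boldsymbol\varphi^{\boldsymbol\mu})\to[\boldsymbol\varphi^{\boldsymbol\mu}]'(\boldsymbol\gamma)$ in $\mathcal C^s(\mathcal X)\times\mathcal C^s(\mathcal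 X)$ as $t\downarrow 0$ whenever $(\boldsymbol\mu_t)_{t>0}\subset\mathcal P_{\mu^1}\times\mathcal P_{\mu^2}$ and $t^{-1}(\boldsymbol\mu_t-\boldsymbol\mu)\to\boldsymbol\gamma$ in $\ell^\infty(B^s)\times\ell^\infty(B^s)$. *)

(* Defs.v *)
From HB Require Import structures.
From mathcomp Require Import all_boot all_order all_algebra.
From mathcomp Require Import all_classical all_reals all_analysis.
Set Implicit Arguments.
Unset Strict Implicit.
Unset Printing Implicit Defensive.
Import Order.TTheory GRing.Theory Num.Theory.
Import numFieldNormedType.Exports.
Local Open Scope classical_set_scope.
Local Open Scope ring_scope.

(* The real functions on T, with pointwise vector-space operations and the
   topology of uniform convergence. *)
Definition ufun (R : realType) (T : choiceType) : Type := T -> R.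

HB.instance Definition _ (R : realType) (T : choiceType) :=
  PseudoMetric.copy (ufun R T) (@arrow_uniform_type T R).
HB.instance Definition _ (R : realType) (T : choiceType) :=
  GRing.Lmodule.copy (ufun R T) (T -> R^o).

Definition euclidean_ball (R : realType) (d : nat) (a : 'rV[R]_d) (r : R) :
    set 'rV[R]_d :=
  [set x | \sum_(i < d) (x 0 i - a 0 i) ^+ 2 <= r ^+ 2].

(* The closed ball as a type, with the subspace topology; its center makes it
   a pointed type, as the library requires of the carrier of a sigma-algebra. *)
Definition Xball (R : realType) (d : nat) (a : 'rV[R]_d) (r : {posnum R}) :
    Type :=
  set_type (euclidean_ball a r%:num).

Section Ball.
Context (R : realType) (d : nat) (a : 'rV[R]_d) (r : {posnum R}).

Lemma euclidean_ball_center : a \in euclidean_ball a r%:num.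
Proof.
by apply/mem_set; rewrite /euclidean_ball /= big1 ?sqr_ge0// => i _;
  rewrite subrr expr0n.
Qed.

HB.instance Definition _ :=
  PseudoMetric.copy (Xball a r) (set_type (euclidean_ball a r%:num)).
HB.instance Definition _ :=
  isPointed.Build (Xball a r) (exist _ a euclidean_ball_center).

End Ball.

(* [pder k f] is the iterated partial derivative D_{i_1} ... D_{i_j} f for
   k = [:: i_1; ...; i_j]. *)
Definition pder (R : realType) (n : nat) (k : seq 'I_n) (f : 'rV[R]_n -> R) :
    'rV[R]_n -> R :=
  foldr (fun i g => fun x => 'D_(delta_mx 0 i) g x) f k.

Definition smooth (R : realType) (n : nat) (f : 'rV[R]_n -> R) : Prop :=
  forall k : seq 'I_n,
    continuous (pder k f) /\
    forall (i : 'I_n) (x : 'rV[R]_n), derivable (pder k f) x (delta_mx 0 i).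

Notation borelX a r := (g_sigma_algebraType (@open (Xball a r))).

Unset Implicit Arguments.

Section Spaces.
Context {R : realType} {d : nat} {a : 'rV[R]_d} {r : {posnum R}}.
Local Notation X := (Xball a r).
Local Notation E := (euclidean_ball a r%:num).

(* A function on X is extended by 0 to R^d in order to be differentiated; the
   extension is irrelevant as derivatives are only taken in the interior. *)
Definition Dk (k : seq 'I_d) (f : X -> R) : 'rV[R]_d -> R :=
  pder k ('valL_(0 : R) f).

Definition Cs (s : nat) : set (ufun R X) :=
  [set f | [/\ continuous (f : X -> R),
    (forall (k : seq 'I_d) (i : 'I_d) (x : 'rV[R]_d), (size k < s)%N ->
      E° x -> derivable (Dk k f) x (delta_mx 0 i)) &
    (forall k : seq 'I_d, (size k <= s)%N ->
      exists2 g : X -> R, continuous g &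
        forall x : X, E° (\val x) -> Dk k f (\val x) = g x)]].

(* The partial derivatives of order j are indexed by the j-tuples of
   coordinate directions instead of the multi-indices of length j: on C^s the
   order of differentiation does not matter, so the maximum is the same. *)
Definition Cs_norm (s : nat) (f : ufun R X) : R :=
  \sum_(j < s.+1) \big[Num.max/0]_(k : j.-tuple 'I_d)
    sup [set `|Dk k f x| | x in E°].

Definition Cs_cvg (s : nat) {T : Type} (F : set_system T)
    (f : T -> ufun R X) (l : ufun R X) : Prop :=
  [/\ \forall t \near F, Cs s (f t), Cs s l &
      Cs_norm s (f t - l) @[t --> F] --> (0 : R)].

Definition Bs (s : nat) : set (ufun R X) :=
  [set f | Cs s f /\ Cs_norm s f <= 1].

(* Functionals on B^s with the topology of uniform convergence. Unbounded
   functionals are not excluded, but l^oo(B^s) is a closed subspace of this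
   space, so that limits and closures of measures are the same in both. *)
Local Notation linf s := (ufun R (Bs s)).

Local Notation P := (probability (borelX a r) R).

Definition emb (s : nat) (mu : P) : linf s :=
  fun f : Bs s => \int[mu]_x (\val f : X -> R) x.

Definition emb2 (s : nat) (mu : P * P) : (linf s * linf s)%type :=
  (emb s mu.1, emb s mu.2).

Definition spt (mu : P) : set X :=
  [set x | forall U : set X, open U -> U x -> (0 < mu U)%E].

Definition P_ (eta : P) : set P := [set nu | spt nu `<=` spt eta].

Definition M_ (s : nat) (eta : P) : set (linf s) :=
  [set g | exists nu (t : R),
    [/\ P_ eta nu, 0 < t & g = t *: (emb s nu - emb s eta)]].

Definition tangent (s : nat) (mu : P * P) : set (linf s * linf s) :=
  closure (M_ s mu.1) `*` closure (M_ s mu.2).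

(* (mu_t)_{t > 0} in P_{mu^1} x P_{mu^2}; the values at t <= 0 are unused. *)
Definition admissible (mu : P * P) (mut : R -> P * P) : Prop :=
  forall t, 0 < t -> P_ mu.1 (mut t).1 /\ P_ mu.2 (mut t).2.

Definition is_potentials (eps : R) (c : 'rV[R]_d -> 'rV[R]_d -> R)
    (x1o x2o : X) (mu : P * P) (phi : ufun R X * ufun R X) : Prop :=
  [/\ continuous (phi.1 : X -> R), continuous (phi.2 : X -> R),
    (forall x1 : X, \int[mu.2]_x2
      expR ((phi.1 x1 + phi.2 x2 - c (\val x1) (\val x2)) / eps) = 1),
    (forall x2 : X, \int[mu.1]_x1
      expR ((phi.1 x1 + phi.2 x2 - c (\val x1) (\val x2)) / eps) = 1) &
    phi.1 x1o = phi.2 x2o].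

Definition lin_hull {V : lmodType R} (A : set V) : set V :=
  [set v | exists n (l : 'I_n -> R) (g : 'I_n -> V),
    (forall i, A (g i)) /\ v = \sum_(i < n) l i *: g i].

(* Only the values of D1 on [tangent s mu] are meaningful. *)
Definition is_hadamard_derivative (s : nat)
    (phi : P * P -> ufun R X * ufun R X) (mu : P * P)
    (D1 : linf s * linf s -> ufun R X * ufun R X) : Prop :=
  [/\ (forall g, tangent s mu g ->
        Cs_cvg s (within (tangent s mu) (nbhs g)) (fun h => (D1 h).1) (D1 g).1 /\
        Cs_cvg s (within (tangent s mu) (nbhs g)) (fun h => (D1 h).2) (D1 g).2),
    (exists L : linf s * linf s -> ufun R X * ufun R X,
        (forall (l : R) u v,
          lin_hull (tangent s mu) u -> lin_hull (tangent s mu) v ->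
          L (l *: u + v) = l *: L u + L v) /\
        (forall g, tangent s mu g -> L g = D1 g)) &
    (forall (mut : R -> P * P) (g : linf s * linf s), admissible mu mut ->
        t^-1 *: (emb2 s (mut t) - emb2 s mu) @[t --> 0^'+] --> g ->
        Cs_cvg s 0^'+ (fun t => (t^-1 *: (phi (mut t) - phi mu)).1) (D1 g).1 /\
        Cs_cvg s 0^'+ (fun t => (t^-1 *: (phi (mut t) - phi mu)).2) (D1 g).2)].

End Spaces.

Notation linf a r s := (ufun _ (@Bs _ _ a r s)).

(* Main.v *)
Require Import Defs.
From HB Require Import structures.
From mathcomp Require Import all_boot all_order all_algebra.
From mathcomp Require Import all_classical all_reals all_analysis.
From mathcomp Require Import measurable_realfun.
From mathcomp Require Import ring lra.
Import Order.TTheory GRing.Theory Num.Theory.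
Import numFieldNormedType.Exports.
Set Implicit Arguments.
Unset Strict Implicit.
Unset Printing Implicit Defensive.
Local Open Scope classical_set_scope.
Local Open Scope ring_scope.

(** The potentials are expanded to second order along [mu_t = mu + t gamma_t],
    directly in the two integral equations that define them.

    Let [p (x1, x2) = exp ((phi_1 (x1) + phi_2 (x2) - c (x1, x2)) / eps)] be the
    density of the entropic plan at [mu], and [h_t = (phi^mu_t - phi^mu) / t].
    In the equations at [mu_t], the terms of order [t] say that the first
    derivative [k = D1 gamma] solves a linear system [A k = - eps gamma (p)],
    where [A (q1, q2) = (q1 + int p q2 dmu^2, q2 + int p q1 dmu^1)]. The terms of
    order [t ^ 2] say that [q_t = (phi^mu_t - phi^mu - t D1 gamma_t) / (t ^ 2 / 2)]
    satisfies [A q_t = F (gamma_t, h_t) + O (t)], where the components of [F] have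
    the form [- 2 gamma (p h) - (1 / eps) int p h ^ 2 dmu]
    ([second_order_expansion]).

    The limit therefore rests on two facts. First, [A] is bounded below on
    pairs normalized by [q1 (x1o) = q2 (x2o)]: each of its integral operators is
    a Markov operator whose density is bounded below by some [delta > 0], hence
    contracts the oscillation by [1 - delta] ([linearized_system_bound]); its range
    is closed ([near_solution_exact]). Second, [F (gamma_t, h_t)] converges to
    [F (gamma, D1 gamma)]. Here [gamma_t] only converges as a functional on the unit
    ball of C^s, so that [p h_t] must converge in C^s. This uses that the Hadamard
    derivative is taken in C^s, and that [p] is smooth with bounds uniform in the
    other variable ([gibbs_Cs_family]), which the integral equations themselves
    imply.

    So [D2 gamma] is the normalized solution of [A q = F (gamma, D1 gamma)]. Its
    existence is obtained from the [q_t] when [gamma] is a multiple of a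
    difference of measures, and then on the closure by continuity of [F] and
    closedness of the range. Continuity of [D2] follows from that of [F], and
    homogeneity of degree 2 holds because [D1] is linear and [F] quadratic. *)

(** * The closed ball as a compact space *)

Section Ball.
Context {R : realType} {d : nat} {a : 'rV[R]_d} {r : {posnum R}}.
Local Notation X := (Xball a r).
Local Notation E := (euclidean_ball a r%:num).

Definition ext (f : X -> R) : 'rV[R]_d -> R := valL_ (0 : R) (A := E) f.

Lemma extE (f : X -> R) (x : X) : ext f (\val x) = f x.
Proof. exact: (congr1 (@^~ x) (@valLK _ _ (0:R) E f)). Qed.

Lemma ball_val (x : X) : E (\val x).
Proof. exact: set_mem (valP x). Qed.

Lemma val_continuous : continuous (\val : X -> 'rV[R]_d).
Proof. exact: initial_continuous. Qed.

Lemma euclidean_dist_continuous :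
  continuous (fun x : 'rV[R]_d => \sum_(i < d) (x 0 i - a 0 i) ^+ 2).
Proof.
apply: continuous_big => [|i _ x]; first exact: add_continuous.
apply: (@continuous_comp _ _ _ (fun x : 'rV[R]_d => x 0 i - a 0 i)
  (fun y : R => y ^+ 2)); last exact: exprn_continuous.
by apply: continuousB; [exact: coord_continuous|exact: cst_continuous].
Qed.

Lemma compact_ball : compact E.
Proof.
apply: bounded_closed_compact.
  exists (`|a| + r%:num); split; first exact: num_real.
  move=> M HM x Ex; apply: le_trans (ltW HM).
  rewrite -(subrK a x) addrC; apply: le_trans (ler_normD _ _) _.
  rewrite lerD2l [leLHS]/Num.norm /= mx_normrE.
  apply/bigmax_leP; split => //= -[i j] _ /=.
  rewrite ord1 !mxE -ler_sqr ?nnegrE// real_normK ?num_real//.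
  by apply: le_trans Ex; rewrite (bigD1 j)//= lerDl sumr_ge0// => ? _; exact: sqr_ge0.
have -> : E = (fun x : 'rV[R]_d => \sum_(i < d) (x 0 i - a 0 i) ^+ 2) @^-1`
   [set y | y <= r%:num ^+ 2] by [].
apply: preimage_closed; first by move=> x _; exact: euclidean_dist_continuous.
exact: closed_le.
Qed.

Lemma compactX : compact [set: X].
Proof.
move=> F PF _.
have [|x [Ex clx]] := compact_ball (fmap_proper_filter (\val : X -> 'rV[R]_d) PF).
  by rewrite /fmap /=; apply: (@filterS _ F _ setT) filterT => x _; exact: ball_val.
exists (exist _ x (mem_set Ex)); split => // A B FA.
move=> [_ [[V oV <-]]] /= Vx VB.
have nV : nbhs x V by apply: open_nbhs_nbhs; split.
have FvA : (\val @ F) (\val @` A).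
  by rewrite /fmap /=; apply: (@filterS _ F _ A) FA => y Ay; exists y.
have [y [[z Az <-] Vy]] := clx _ _ FvA nV.
by exists z; split => //; exact: VB.
Qed.

Lemma open_ball_interior (x : 'rV[R]_d) :
  \sum_(i < d) (x 0 i - a 0 i) ^+ 2 < r%:num ^+ 2 -> E° x.
Proof.
move=> xr; rewrite /interior.
have h : nbhs x ((fun x : 'rV[R]_d => \sum_(i < d) (x 0 i - a 0 i) ^+ 2)
    @^-1` [set y | y < r%:num ^+ 2]).
  apply: euclidean_dist_continuous.
  by apply: open_nbhs_nbhs; split; [exact: open_lt|].
by apply: filterS h => y /ltW.
Qed.

(** Radial contraction towards the center moves every point of the ball into
    the open ball, which lies in the interior. *)
Lemma interior_dense (x : X) (V : set X) : nbhs x V ->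
  exists y : X, V y /\ E° (\val y).
Proof.
move=> [_ [[W oW <-]]] /= Wx WV.
have Ex := ball_val x.
pose g (l : R) : 'rV[R]_d := \val x + l *: (a - \val x).
have gc : {for 0, continuous g}.
  rewrite /g /continuous_at; apply: cvgD; first exact: cvg_cst.
  by apply: cvgZr_tmp; exact: cvg_id.
have := gc W; rewrite {1}/g scale0r addr0 => /(_ _)[|e /= e0 he].
  by apply: open_nbhs_nbhs; split.
pose l := Num.min (e/2) (1/2).
have l0 : 0 < l by rewrite lt_min !divr_gt0.
have l1 : l < 1.
  by rewrite gt_min; apply/orP; right; rewrite ltr_pdivrMr// mul1r ltr1n.
have gE : \sum_(i < d) (g l 0 i - a 0 i) ^+ 2 < r%:num ^+ 2.
  have -> : \sum_(i < d) (g l 0 i - a 0 i) ^+ 2 =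
      (1 - l) ^+ 2 * \sum_(i < d) (\val x 0 i - a 0 i) ^+ 2.
    rewrite mulr_sumr; apply: eq_bigr => i _; rewrite !mxE.
    by ring.
  apply: (@le_lt_trans _ _ ((1 - l) ^+ 2 * r%:num ^+ 2)).
    by rewrite ler_wpM2l// sqr_ge0.
  by rewrite gtr_pMl ?exprn_gt0// expr_lt1//; lra.
have Eg := open_ball_interior gE.
exists (exist _ (g l) (mem_set (interior_subset Eg))); split => //.
apply: WV => /=; apply: he => /=.
rewrite sub0r normrN gtr0_norm// /l gt_min; apply/orP; left.
by rewrite ltr_pdivrMr// ltr_pMr// ltr1n.
Qed.

Lemma interior_bound (f : X -> R) (B : R) : continuous f ->
  (forall x : X, E° (\val x) -> `|f x| <= B) -> forall x, `|f x| <= B.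
Proof.
move=> fc fB x; rewrite leNgt; apply/negP => Bx.
have [|y [/= By /fB]] := @interior_dense x ((fun y => `|f y|) @^-1` [set z | B < z]).
  have : {for x, continuous (fun y => `|f y|)}.
    by apply: continuous_comp (fc x) _; exact: norm_continuous.
  by apply; apply: open_nbhs_nbhs; split => //; exact: open_gt.
by rewrite leNgt By.
Qed.

Lemma bounded_continuous (f : X -> R) : continuous f ->
  exists2 B : R, 0 < B & forall x, `|f x| <= B.
Proof.
move=> fc.
have := @continuous_compact _ _ f [set: X] (continuous_subspaceT fc) compactX.
move=> /compact_bounded [M [Mr HM]].
exists (`|M| + 1); first by rewrite ltr_wpDl.
move=> x; apply: HM; last by exists x.
by rewrite (le_lt_trans (ler_norm _))// ltrDl.
Qed.

(** The product is given explicitly as a topological space: inference would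
    otherwise find its neighborhoods only, and later unifications slow down. *)
Definition continuous2 (f : X -> X -> R) : Prop :=
  continuous (fun z : ((X * X)%type : topologicalType) => f z.1 z.2).

Lemma bounded_continuous2 (f : X -> X -> R) : continuous2 f ->
  exists2 B : R, 0 < B & forall x y, `|f x y| <= B.
Proof.
move=> fc.
have cXX : compact [set: X * X].
  by rewrite -setXTT; apply: compact_setX; exact: compactX.
have := @continuous_compact _ _ (fun z : X * X => f z.1 z.2) _
  (continuous_subspaceT fc) cXX.
move=> /compact_bounded [M [Mr HM]].
exists (`|M| + 1); first by rewrite ltr_wpDl.
move=> x y; apply: HM; last by exists (x, y).
by rewrite (le_lt_trans (ler_norm _))// ltrDl.
Qed.

End Ball.

(** * Continuous functions and their integrals *)

Section Continuity.
Context {R : realType} {T : topologicalType}.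
Implicit Types f g : T -> R.

Lemma continuous_near f :
  (forall x e, 0 < e -> \forall x' \near x, `|f x - f x'| <= e) -> continuous f.
Proof. by move=> h x; apply/cvgrPdist_le => e; exact: h. Qed.

Lemma continuous_add f g : continuous f -> continuous g ->
  continuous (fun x => f x + g x).
Proof. by move=> fc gc x; apply: (cvgD (fc x) (gc x)). Qed.

Lemma continuous_sub f g : continuous f -> continuous g ->
  continuous (fun x => f x - g x).
Proof. by move=> fc gc x; apply: (cvgB (fc x) (gc x)). Qed.

Lemma continuous_mul f g : continuous f -> continuous g ->
  continuous (fun x => f x * g x).
Proof. by move=> fc gc x; apply: (cvgM (fc x) (gc x)). Qed.

Lemma continuous_scale (k : R) g : continuous g ->
  continuous (fun x => k * g x).
Proof. by move=> gc; apply: continuous_mul => //; exact: cst_continuous. Qed.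

Lemma continuous_expn f n : continuous f -> continuous (fun x => f x ^+ n).
Proof.
move=> fc x; apply: (@continuous_comp _ _ _ f (fun y : R => y ^+ n)).
  exact: fc.
exact: exprn_continuous.
Qed.

Lemma continuous_abs f : continuous f -> continuous (fun x => `|f x|).
Proof. by move=> fc x; apply: (continuous_comp (fc x)); exact: norm_continuous. Qed.

Lemma continuous_exp f : continuous f -> continuous (fun x => expR (f x)).
Proof. by move=> fc x; apply: (continuous_comp (fc x)); exact: continuous_expR. Qed.

Lemma continuous_inv f : continuous f -> (forall x, f x != 0) ->
  continuous (fun x => (f x)^-1).
Proof. by move=> fc f0 x; apply: cvgV; [exact: f0|exact: fc]. Qed.

End Continuity.

Section Integral.
Context {R : realType} {d : nat} {a : 'rV[R]_d} {r : {posnum R}}.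
Local Notation X := (Xball a r).
Local Notation P := (probability (borelX a r) R).
Implicit Types (f g : X -> R) (mu : P).

Lemma measurable_continuous f : continuous f ->
  measurable_fun setT (f : borelX a r -> R).
Proof.
move=> /continuousP fc; apply: (measurability _ (RGenOpens.measurableE R)).
move=> _ [_ [x [y ->]] <-]; rewrite setTI; apply: sub_sigma_algebra.
exact/fc/interval_open.
Qed.

Lemma integrable_continuous mu f : continuous f ->
  mu.-integrable setT (EFin \o (f : borelX a r -> R)).
Proof.
move=> fc; apply: measurable_bounded_integrable => //.
- by apply: le_lt_trans (probability_le1 _ _) _ => //; rewrite ltry.
- exact: measurable_continuous.
- have [B _ fB] := bounded_continuous fc.
  exists B; split; first exact: num_real.
  by move=> M BM x _; apply: le_trans (fB x) (ltW BM).
Qed.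

Lemma integralD_continuous mu f g : continuous f -> continuous g ->
  \int[mu]_x (f x + g x) = \int[mu]_x f x + \int[mu]_x g x.
Proof. by move=> fc gc; rewrite RintegralD//; exact: integrable_continuous. Qed.

Lemma integralB_continuous mu f g : continuous f -> continuous g ->
  \int[mu]_x (f x - g x) = \int[mu]_x f x - \int[mu]_x g x.
Proof. by move=> fc gc; rewrite RintegralB//; exact: integrable_continuous. Qed.

Lemma integralZ_continuous mu k f : continuous f ->
  \int[mu]_x (k * f x) = k * \int[mu]_x f x.
Proof. by move=> fc; rewrite RintegralZl//; exact: integrable_continuous. Qed.

Lemma integral_probability_cst mu (k : R) : \int[mu]_x k = k.
Proof. by rewrite Rintegral_cst//= probability_setT mulr1. Qed.

Lemma integral_continuous_le mu f g : continuous f -> continuous g ->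
  (forall x, f x <= g x) -> \int[mu]_x f x <= \int[mu]_x g x.
Proof.
move=> fc gc fg; apply: le_Rintegral => //; exact: integrable_continuous.
Qed.

Lemma integral_norm_le mu f (B : R) : continuous f -> (forall x, `|f x| <= B) ->
  `|\int[mu]_x f x| <= B.
Proof.
move=> fc fB; apply: le_trans (le_normr_Rintegral _ _) _ => //.
  exact: integrable_continuous.
rewrite -[leRHS](integral_probability_cst mu).
apply: integral_continuous_le => //; last exact: cst_continuous.
exact: continuous_abs.
Qed.

Section Mixture.
Variables (mu nu : P) (l : R) (l0 : 0 <= l) (l1 : l <= 1).

Let onem_l : 0 <= 1 - l. Proof. by rewrite subr_ge0. Qed.

Definition mixture : set (borelX a r) -> \bar R :=
  measure_add (mscale (NngNum onem_l) mu) (mscale (NngNum l0) nu).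

HB.instance Definition _ := Measure.on mixture.

Let mixture_setT : mixture setT = 1%E.
Proof.
rewrite /mixture measure_addE/= /mscale/= !probability_setT !mule1 -EFinD.
by rewrite subrK.
Qed.

HB.instance Definition _ :=
  @Measure_isProbability.Build _ _ R mixture mixture_setT.

Lemma mixtureE A : mixture A = ((1 - l)%:E * mu A + l%:E * nu A)%E.
Proof. by rewrite /mixture measure_addE. Qed.

(** Sums and multiples of measures are first treated for nonnegative functions;
    a continuous function becomes nonnegative by adding a constant. *)
Let integral_mixture_ge0 f : continuous f -> (forall x, 0 <= f x) ->
  \int[mixture]_x f x = (1 - l) * \int[mu]_x f x + l * \int[nu]_x f x.
Proof.
move=> fc f0; have mf := measurable_continuous fc.
have f0E x : (0 <= (f x)%:E)%E by rewrite lee_fin.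
rewrite /Rintegral /mixture ge0_integral_measure_add//=; last first.
  exact/measurable_EFinP.
rewrite !ge0_integral_mscale//=; try exact/measurable_EFinP.
have fin (m : P) : (\int[m]_x (f x)%:E)%E \is a fin_num.
  by apply: integrable_fin_num => //; exact: integrable_continuous.
by rewrite fineD ?fineM ?fin_numM.
Qed.

Lemma integral_mixture f : continuous f ->
  \int[mixture]_x f x = (1 - l) * \int[mu]_x f x + l * \int[nu]_x f x.
Proof.
move=> fc; have [B _ fB] := bounded_continuous fc.
have gc : continuous (fun x => f x + B).
  by apply: continuous_add => //; exact: cst_continuous.
have := integral_mixture_ge0 gc.
rewrite !integralD_continuous ?integral_probability_cst//; try exact: cst_continuous.
move=> h.
suff fB0 x : 0 <= f x + B by have := h fB0; lra.
by have := fB x; rewrite ler_norml => /andP[+ _]; rewrite -lerBlDr sub0r.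
Qed.

End Mixture.

End Integral.

(** * Mean value bounds and directional derivatives *)

Section RealAnalysis.
Context {R : realType}.

(** A mean value inequality around an approximate slope [c]. It serves with
    [c = 0] for Taylor remainders, and with [c] the derivative at [0] for the
    convergence of difference quotients, uniformly in a family of functions. *)
Lemma mean_value_bound (g g' : R -> R) (h c e : R) :
  (forall t, `|t| <= `|h| -> is_derive t (1 : R) g (g' t)) ->
  (forall t, `|t| <= `|h| -> `|g' t - c| <= e) ->
  `|g h - g 0 - c * h| <= e * `|h|.
Proof.
move=> dg ge.
have [h0|h0] := leP 0 h.
  have th t : t \in `[0, h] -> `|t| <= `|h|.
    by rewrite in_itv/= => /andP[t0 th]; rewrite !ger0_norm.
  have [||t /th tI] := @MVT_segment R g g' _ _ h0.
  - by move=> t /subset_itv_oo_cc /th; exact: dg.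
  - by apply: derivable_within_continuous => t /th /dg [].
  rewrite subr0 => ->; rewrite -mulrBl normrM ler_wpM2r//; exact: ge.
have th t : t \in `[h, 0] -> `|t| <= `|h|.
  by rewrite in_itv/= => /andP[t0 th]; rewrite ler0_norm ?(ltr0_norm h0)// lerN2.
have [||t /th tI] := @MVT_segment R g g' _ _ (ltW h0).
- by move=> t /subset_itv_oo_cc /th; exact: dg.
- by apply: derivable_within_continuous => t /th /dg [].
rewrite sub0r => gE.
have -> : g h - g 0 - c * h = (g' t - c) * h by lra.
by rewrite normrM ler_wpM2r//; exact: ge.
Qed.

Lemma derivative_growth (g g' : R -> R) (K : R) (n : nat) :
  (forall t, is_derive t (1 : R) g (g' t)) -> g 0 = 0 -> 0 <= K ->
  (forall t, `|t| <= 1 -> `|g' t| <= K * `|t| ^+ n) ->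
  forall t, `|t| <= 1 -> `|g t| <= K * `|t| ^+ n.+1.
Proof.
move=> dg g0 K0 gK t t1.
have := @mean_value_bound g g' t 0 (K * `|t| ^+ n).
rewrite g0 mul0r !subr0 exprSr mulrA; apply => // u ut.
rewrite subr0; apply: le_trans (gK u (le_trans ut t1)) _.
by rewrite ler_wpM2l// lerXn2r ?nnegrE.
Qed.

(** The growth estimate is applied three times, starting from the bound of the
    third derivative by [expR 1]. *)
Lemma expR_taylor2 (z : R) : `|z| <= 1 ->
  `|expR z - 1 - z - z ^+ 2 / 2| <= expR 1 * `|z| ^+ 3.
Proof.
have e0 : 0 <= expR 1 :> R := expR_ge0 1.
have d1 t : is_derive t (1 : R) (fun t => expR t - 1) (expR t).
  by have := is_deriveB (is_derive_expR t) (is_derive_cst (1 : R) t 1); rewrite subr0.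
have d2 t : is_derive t (1 : R) (fun t => expR t - 1 - t) (expR t - 1).
  exact: is_deriveB (d1 t) (is_derive_id t 1).
have d3 t : is_derive t (1 : R) (fun t => expR t - 1 - t - t ^+ 2 / 2) (expR t - 1 - t).
  have h : is_derive t (1 : R) (fun t => t ^+ 2 / 2) t.
    have := is_deriveZ (2^-1) (is_deriveX 2 (is_derive_id t (1 : R))).
    rewrite (_ : _ *: _ = t); last by rewrite /= expr1 /GRing.scale /=; field.
    by congr is_derive; apply/funext => u; rewrite /GRing.scale /= mulrC.
  exact: is_deriveB (d2 t) h.
move: z.
apply: (@derivative_growth _ (fun t => expR t - 1 - t)) => //.
- by rewrite expR0 expr0n mul0r subrr !subr0.
apply: (@derivative_growth _ (fun t => expR t - 1)) => // [|].
- by rewrite expR0 subrr subr0.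
apply: (@derivative_growth _ (fun t => expR t)) => // [|t t1].
- by rewrite expR0 subrr.
rewrite expr0 mulr1 gtr0_norm ?expR_gt0// ler_expR.
exact: le_trans (ler_norm _) t1.
Qed.

End RealAnalysis.

Section Line.
Context {R : realType} {V : normedModType R}.

(** A partial derivative is an ordinary derivative along a line, which makes
    the one-variable chain rule and mean value theorem available. *)
Lemma is_derive_line (F : V -> R) (x v : V) (h : R) (l : R) :
  is_derive (h *: v + x) v F l <->
  is_derive h (1 : R) (fun t : R => F (t *: v + x)) l.
Proof.
pose q := fun t : R => t^-1 *: ((F \o shift (h *: v + x)) (t *: v) - F (h *: v + x)).
have qE : q = fun t : R => t^-1 *: (((fun t : R => F (t *: v + x)) \o shift h) (t *: (1 : R))
    - F (h *: v + x)).
  apply/funext => t; rewrite /q /=; congr (_ *: (F _ - _)).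
  by rewrite scalerDl addrA [t *: 1]mulr1.
split=> -[]; rewrite /derivable /derive -/q => c e.
- by split; rewrite /derivable /derive -qE.
- by split; rewrite /derivable /derive -/q qE.
Qed.

Lemma is_derive_comp_real (f : R -> R) (F : V -> R) (x v : V) (l m : R) :
  is_derive (F x) (1 : R) f m -> is_derive x v F l ->
  is_derive x v (f \o F) (m * l).
Proof.
move=> df dF.
have xE : x = (0 : R) *: v + x by rewrite scale0r add0r.
rewrite [x in is_derive x]xE; apply/is_derive_line.
apply: (@is_derive1_comp _ f (fun t : R => F (t *: v + x))).
  by rewrite -xE.
by apply/is_derive_line; rewrite -xE.
Qed.

End Line.

(** * Balls of C^s functions and C^s families *)

Section Sections.
Context {T U V : topologicalType}.

Lemma continuous_sectionl (F : T * U -> V) (x : U) :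
  continuous F -> continuous (fun y => F (y, x)).
Proof.
move=> Fc y; apply: (@cvg_comp _ _ _ (fun y => (y, x)) F); last exact: Fc.
by apply: cvg_pair; [exact: cvg_id|exact: cvg_cst].
Qed.

Lemma continuous_sectionr (F : T * U -> V) (y : T) :
  continuous F -> continuous (fun x => F (y, x)).
Proof.
move=> Fc x; apply: (@cvg_comp _ _ _ (fun x => (y, x)) F); last exact: Fc.
by apply: cvg_pair; [exact: cvg_cst|exact: cvg_id].
Qed.

Lemma continuous_fst_comp (g : T -> V) :
  continuous g -> continuous (fun z : T * U => g z.1).
Proof. by move=> gc z; apply: (@cvg_comp _ _ _ fst g); [exact: cvg_fst|exact: gc]. Qed.

Lemma continuous_snd_comp (g : U -> V) :
  continuous g -> continuous (fun z : T * U => g z.2).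
Proof. by move=> gc z; apply: (@cvg_comp _ _ _ snd g); [exact: cvg_snd|exact: gc]. Qed.

End Sections.

Lemma continuous_prod_map {T T' U U' : topologicalType} (f : T -> U) (g : T' -> U') :
  continuous f -> continuous g -> continuous (fun z : T * T' => (f z.1, g z.2)).
Proof.
move=> fc gc z; apply: cvg_pair.
  by apply: (@cvg_comp _ _ _ fst f); [exact: cvg_fst|exact: fc].
by apply: (@cvg_comp _ _ _ snd g); [exact: cvg_snd|exact: gc].
Qed.

Section Smooth.
Context {R : realType} {d : nat} {a : 'rV[R]_d} {r : {posnum R}}.
Local Notation X := (Xball a r).
Local Notation E := (euclidean_ball a r%:num).
Local Notation P := (probability (borelX a r) R).
Implicit Types (f g : X -> R) (F G : X -> X -> R).

(** The derivative of the extension by 0 is only prescribed in the interior,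
    while [g] is a function on the whole ball: this is how a derivative that
    extends continuously to the boundary is expressed. *)
Definition pderiv (i : 'I_d) f g : Prop := forall x : X, E° (\val x) ->
  is_derive (\val x) (delta_mx 0 i : 'rV[R]_d) (ext f) (g x).

Lemma is_derive_ext (f : X -> R) (H : 'rV[R]_d -> R) (x : X) v l :
  (forall y : X, f y = H (\val y)) -> E° (\val x) ->
  is_derive (\val x) v H l -> is_derive (\val x) v (ext f) l.
Proof.
move=> fH Ex; apply: near_eq_is_derive; move: Ex; apply: filterS => y Ey.
have := fH (exist _ y (mem_set Ey)); rewrite -extE /=.
by move=> ->.
Qed.

Lemma pderiv_cst i (k : R) : pderiv i (fun=> k) (fun=> 0).
Proof.
move=> x Ex; apply: (is_derive_ext (H := cst k)) => //; exact: is_derive_cst.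
Qed.

Lemma pderivD i f g f' g' : pderiv i f f' -> pderiv i g g' ->
  pderiv i (fun x => f x + g x) (fun x => f' x + g' x).
Proof.
move=> df dg x Ex; apply: (is_derive_ext (H := ext f + ext g)) => // [y|].
  by rewrite fctE !extE.
by apply: is_deriveD; [exact: df|exact: dg].
Qed.

Lemma pderivM i f g f' g' : pderiv i f f' -> pderiv i g g' ->
  pderiv i (fun x => f x * g x) (fun x => f x * g' x + g x * f' x).
Proof.
move=> df dg x Ex; apply: (is_derive_ext (H := ext f * ext g)) => // [y|].
  by rewrite fctE !extE.
have := is_deriveM (df x Ex) (dg x Ex); rewrite !extE; exact.
Qed.

Lemma pderiv_exp i f f' : pderiv i f f' ->
  pderiv i (fun x => expR (f x)) (fun x => expR (f x) * f' x).
Proof.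
move=> df x Ex; apply: (is_derive_ext (H := expR \o ext f)) => // [y|].
  by rewrite /= -/(ext f) extE.
apply: is_derive_comp_real (df x Ex); rewrite extE.
exact: is_derive_expR.
Qed.

Lemma pderiv_inv i f f' : (forall x, f x != 0) -> pderiv i f f' ->
  pderiv i (fun x => (f x)^-1) (fun x => - 1 * ((f x)^-1 * (f x)^-1) * f' x).
Proof.
move=> f0 df x Ex.
apply: (is_derive_ext (H := fun y => (ext f y)^-1)) => // [y|].
  by rewrite extE.
have fx0 : ext f (\val x) != 0 by rewrite extE.
have [dfx dfE] := df x Ex.
split; first exact: derivableV.
by rewrite deriveV// dfE extE mulN1r -invfM -expr2.
Qed.

(** The ball of radius [B] of C^s for the maximum of all derivatives of order at
    most [s]. The recursion over single partial derivatives makes the product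
    rule a plain induction; [Cs_ball_Cs] and [Cs_ball_of_norm] compare it with
    the C^s norm. *)
Fixpoint Cs_ball (s : nat) (B : R) f : Prop :=
  [/\ continuous f, (forall x, `|f x| <= B) &
  if s is n.+1 then forall i, exists g, pderiv i f g /\ Cs_ball n B g else True].

(** Families [F y] of C^s functions whose derivatives are jointly continuous in
    [(y, x)]. By compactness the C^s bounds are then uniform in [y]
    ([Cs_family_bound]). *)
Fixpoint Cs_family (s : nat) F : Prop :=
  continuous2 F /\
  if s is n.+1 then forall i, exists G, (forall y, pderiv i (F y) (G y)) /\ Cs_family n G
  else True.

Lemma Cs_ball_continuous s B f : Cs_ball s B f -> continuous f.
Proof. by case: s => [|s] []. Qed.

Lemma Cs_ball_bound s B f : Cs_ball s B f -> forall x, `|f x| <= B.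
Proof. by case: s => [|s] []. Qed.

Lemma Cs_ball_ge0 s B f : Cs_ball s B f -> 0 <= B.
Proof. by move=> /Cs_ball_bound/(_ point); exact: le_trans. Qed.

Lemma Cs_ball_le s A B f : A <= B -> Cs_ball s A f -> Cs_ball s B f.
Proof.
move=> AB; elim: s f => [|s IH] f [fc fA df].
  by split => // x; exact: le_trans (fA x) AB.
split => //; first by move=> x; exact: le_trans (fA x) AB.
by move=> i; have [g [dg /IH Cg]] := df i; exists g.
Qed.

Lemma Cs_ballW s B f : Cs_ball s.+1 B f -> Cs_ball s B f.
Proof.
elim: s f => [|s IH] f; first by case.
move=> [fc fB df]; split => // i.
by have [g [dg /IH Cg]] := df i; exists g.
Qed.

Lemma Cs_ball_cst s (k : R) : Cs_ball s `|k| (fun=> k).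
Proof.
elim: s k => [|s IH] k; split => //; try exact: cst_continuous.
move=> i; exists (fun=> 0); split; first exact: pderiv_cst.
by apply: Cs_ball_le (IH 0); rewrite normr0.
Qed.

Lemma Cs_ballD s A B f g : Cs_ball s A f -> Cs_ball s B g ->
  Cs_ball s (A + B) (fun x => f x + g x).
Proof.
elim: s f g => [|s IH] f g [fc fA df] [gc gB dg]; split => //;
  try exact: continuous_add.
- by move=> x; apply: le_trans (ler_normD _ _) _; exact: lerD.
- by move=> x; apply: le_trans (ler_normD _ _) _; exact: lerD.
move=> i; have [f' [df' Cf']] := df i; have [g' [dg' Cg']] := dg i.
by exists (fun x => f' x + g' x); split; [exact: pderivD|exact: IH].
Qed.

(** Each order of differentiation doubles the number of terms of the product
    rule, whence the factor [2 ^+ s]. *)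
Lemma Cs_ballM s A B f g : Cs_ball s A f -> Cs_ball s B g ->
  Cs_ball s (2 ^+ s * (A * B)) (fun x => f x * g x).
Proof.
elim: s A B f g => [|s IH] A B f g Cf Cg;
  have A0 := Cs_ball_ge0 Cf; have B0 := Cs_ball_ge0 Cg;
  have fgB x : `|f x * g x| <= A * B by
    rewrite normrM ler_pM//; [exact: Cs_ball_bound Cf x|exact: Cs_ball_bound Cg x].
  rewrite expr0 mul1r; split => //.
  by apply: continuous_mul; [exact: Cs_ball_continuous Cf|exact: Cs_ball_continuous Cg].
split => //.
- by apply: continuous_mul; [exact: Cs_ball_continuous Cf|exact: Cs_ball_continuous Cg].
- move=> x; apply: le_trans (fgB x) _; rewrite ler_peMl ?mulr_ge0//.
  by apply: exprn_ege1; rewrite ler1n.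
move=> i; have [_ _ /(_ i)[f' [df' Cf']]] := Cf.
have [_ _ /(_ i)[g' [dg' Cg']]] := Cg.
exists (fun x => f x * g' x + g x * f' x); split; first exact: pderivM.
have -> : 2 ^+ s.+1 * (A * B) = 2 ^+ s * (A * B) + 2 ^+ s * (B * A).
  by rewrite exprS; ring.
by apply: Cs_ballD; apply: IH => //; exact: Cs_ballW.
Qed.

Lemma Cs_ballZ s B k f : Cs_ball s B f -> Cs_ball s (`|k| * B) (fun x => k * f x).
Proof.
elim: s f => [|s IH] f Cf; have [fc fB df] := Cf; split => //;
  try exact: continuous_scale.
- by move=> x; rewrite normrM ler_wpM2l.
- by move=> x; rewrite normrM ler_wpM2l.
move=> i; have [f' [df' Cf']] := df i.
exists (fun x => k * f' x); split; last exact: IH.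
move=> x Ex; have := pderivM (pderiv_cst i k) df' Ex.
by rewrite mulr0 addr0.
Qed.

Lemma Cs_ballB s A B f g : Cs_ball s A f -> Cs_ball s B g ->
  Cs_ball s (A + B) (fun x => f x - g x).
Proof.
move=> Cf Cg.
have := Cs_ballD Cf (Cs_ballZ (-1) Cg); rewrite normrN1 mul1r.
by under eq_fun do rewrite mulN1r.
Qed.

Lemma Cs_family_continuous s F : Cs_family s F -> continuous2 F.
Proof. by case: s => [|s] []. Qed.

Lemma Cs_family_continuousl s F x : Cs_family s F -> continuous (F^~ x).
Proof.
move=> /Cs_family_continuous Fc y.
exact: (@continuous_sectionl X X R _ x Fc).
Qed.

Lemma Cs_family_continuousr s F y : Cs_family s F -> continuous (F y).
Proof.
move=> /Cs_family_continuous Fc x.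
exact: (@continuous_sectionr X X R _ y Fc).
Qed.

Lemma Cs_familyW s F : Cs_family s.+1 F -> Cs_family s F.
Proof.
elim: s F => [|s IH] F; first by case.
by move=> [Fc dF]; split => // i; have [G [dG /IH CG]] := dF i; exists G.
Qed.

Lemma Cs_family_param s f : continuous f -> Cs_family s (fun y _ => f y).
Proof.
have c1 g : continuous g -> continuous2 (fun y _ => g y).
  exact: (@continuous_fst_comp X X R).
elim: s f => [|s IH] f fc; split; try exact: c1.
  by [].
move=> i; exists (fun _ _ => 0); split; first by move=> y; exact: pderiv_cst.
by apply: IH; exact: cst_continuous.
Qed.

Lemma Cs_familyD s F G : Cs_family s F -> Cs_family s G ->
  Cs_family s (fun y x => F y x + G y x).
Proof.
elim: s F G => [|s IH] F G [Fc dF] [Gc dG]; split.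
- exact: continuous_add Fc Gc.
- by [].
- exact: continuous_add Fc Gc.
move=> i; have [F' [dF' CF']] := dF i; have [G' [dG' CG']] := dG i.
exists (fun y x => F' y x + G' y x); split; last exact: IH.
by move=> y; exact: pderivD.
Qed.

Lemma Cs_familyM s F G : Cs_family s F -> Cs_family s G ->
  Cs_family s (fun y x => F y x * G y x).
Proof.
elim: s F G => [|s IH] F G CF CG; have [Fc dF] := CF; have [Gc dG] := CG;
  split.
- exact: continuous_mul Fc Gc.
- by [].
- exact: continuous_mul Fc Gc.
move=> i; have [F' [dF' CF']] := dF i; have [G' [dG' CG']] := dG i.
exists (fun y x => F y x * G' y x + G y x * F' y x); split.
  by move=> y; exact: pderivM.
by apply: Cs_familyD; apply: IH => //; exact: Cs_familyW.
Qed.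

Lemma Cs_family_exp s F : Cs_family s F -> Cs_family s (fun y x => expR (F y x)).
Proof.
elim: s F => [|s IH] F CF; have [Fc dF] := CF; split.
- exact: continuous_exp Fc.
- by [].
- exact: continuous_exp Fc.
move=> i; have [F' [dF' CF']] := dF i.
exists (fun y x => expR (F y x) * F' y x); split.
  by move=> y; exact: pderiv_exp.
by apply: Cs_familyM => //; apply: IH; exact: Cs_familyW.
Qed.

Lemma Cs_family_inv s F : (forall y x, F y x != 0) -> Cs_family s F ->
  Cs_family s (fun y x => (F y x)^-1).
Proof.
move=> F0; elim: s F F0 => [|s IH] F F0 CF; have [Fc dF] := CF; split.
- exact: continuous_inv Fc (fun z => F0 z.1 z.2).
- by [].
- exact: continuous_inv Fc (fun z => F0 z.1 z.2).
move=> i; have [F' [dF' CF']] := dF i.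
exists (fun y x => - 1 * ((F y x)^-1 * (F y x)^-1) * F' y x); split.
  by move=> y; exact: pderiv_inv.
have CFV : Cs_family s (fun y x => (F y x)^-1) by apply: IH => //; exact: Cs_familyW.
apply: Cs_familyM => //; apply: Cs_familyM; last exact: Cs_familyM.
by apply: Cs_family_param; exact: cst_continuous.
Qed.

Lemma Cs_family_bound s F : Cs_family s F ->
  exists2 B, 0 < B & forall y, Cs_ball s B (F y).
Proof.
elim: s F => [|s IH] F CF; have [Fc dF] := CF;
  have [B0 B0_gt0 FB0] := bounded_continuous2 Fc.
  by exists B0 => // y; split => //; exact: (Cs_family_continuousr CF).
have /choice[b bP] : forall i, exists b : R, 0 < b /\
    forall y, exists g, pderiv i (F y) g /\ Cs_ball s b g.
  move=> i; have [G [dG /IH[b b0 Gb]]] := dF i.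
  by exists b; split => // y; exists (G y).
have b_ge0 i : 0 <= b i by have [/ltW] := bP i.
exists (B0 + \sum_i b i); first by rewrite ltr_wpDr// sumr_ge0.
move=> y; split; first exact: (Cs_family_continuousr CF).
  by move=> x; apply: le_trans (FB0 y x) _; rewrite lerDl sumr_ge0.
move=> i; have [_ /(_ y)[g [dg Cg]]] := bP i.
exists g; split => //; apply: Cs_ball_le Cg.
by rewrite (bigD1 i)//= addrCA lerDl addr_ge0 ?(ltW B0_gt0)// sumr_ge0.
Qed.

End Smooth.

(** * Differentiation under the integral sign *)

Section IntegralDerivative.
Context {R : realType} {d : nat} {a : 'rV[R]_d} {r : {posnum R}}.
Local Notation X := (Xball a r).
Local Notation E := (euclidean_ball a r%:num).
Local Notation P := (probability (borelX a r) R).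
Implicit Types (f g : X -> R) (F G : X -> X -> R).

(** The tube lemma: compactness in [y] makes continuity at [x] uniform. *)
Lemma near_uniform F (x : X) (e : R) : continuous2 F -> 0 < e ->
  \forall x' \near x, forall y, `|F y x' - F y x| < e.
Proof.
move=> Fc e0.
have cov := (iffLR (compact_near_coveringP [set: X]) compactX) X (nbhs x)
  (fun x' y => `|F y x' - F y x| < e) (nbhs_filter x).
apply: (filterS _ (cov _)) => [x' H y|y _]; first exact: H.
have e20 : 0 < e / 2 by rewrite divr_gt0.
have /cvgrPdist_lt/(_ _ e20) := Fc (y, x).
rewrite /= => -[[U V] /= [Uy Vx] UV].
exists (U, V) => //= -[y' x'] /= [Uy' Vx'].
have h1 := UV (y', x') (conj Uy' Vx').
have h2 := UV (y', x) (conj Uy' (nbhs_singleton Vx)).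
rewrite /= in h1 h2.
rewrite (_ : F y' x' - F y' x = (F y x - F y' x) - (F y x - F y' x')); last by ring.
by apply: le_lt_trans (ler_normB _ _) _; lra.
Qed.

Lemma integral_continuous2 F (mu : P) : continuous2 F ->
  continuous (fun x => \int[mu]_y F y x).
Proof.
move=> Fc; apply: continuous_near => x e e0.
have := near_uniform x Fc e0; apply: filterS => x' Fx'.
have Fx z : continuous (F^~ z) by exact: (@continuous_sectionl X X R _ z Fc).
rewrite -integralB_continuous//; apply: integral_norm_le.
  exact: continuous_sub.
by move=> y; rewrite distrC ltW.
Qed.

(** The difference quotients converge uniformly in the integration variable, by
    [mean_value_bound] and [near_uniform]. *)
Lemma pderiv_integral i F G (mu : P) : continuous2 F -> continuous2 G ->
  (forall y, pderiv i (F y) (G y)) ->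
  pderiv i (fun x => \int[mu]_y F y x) (fun x => \int[mu]_y G y x).
Proof.
move=> Fc Gc dF x Ex.
have Fx z : continuous (F^~ z) by exact: (@continuous_sectionl X X R _ z Fc).
have Gx z : continuous (G^~ z) by exact: (@continuous_sectionl X X R _ z Gc).
set v : 'rV[R]_d := delta_mx 0 i.
set Phi := fun x => \int[mu]_y F y x.
set l := \int[mu]_y G y x.
suff ql : h^-1 *: ((ext Phi \o shift (\val x)) (h *: v) - ext Phi (\val x))
    @[h --> 0^'] --> l.
  by split; [apply: cvgP ql|exact: cvg_lim ql].
apply/cvgrPdist_le => e e0.
have [_ [[W oW <-]]] := near_uniform x Gc e0.
move=> /= Wx We.
have NW : nbhs (\val x) (E° `&` W).
  by apply: filterI; [exact: open_nbhs_nbhs (conj (open_interior _) Ex)|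
    exact: open_nbhs_nbhs (conj oW Wx)].
have cl : {for 0, continuous (fun h : R => h *: v + \val x)}.
  have zc : (fun h : R => h *: v) @ (0 : R) --> (0 : R) *: v.
    by apply: cvgZr_tmp; exact: cvg_id.
  exact: cvgD zc (cvg_cst _).
have := cl (E° `&` W); rewrite /= scale0r add0r => /(_ NW)[eta /= eta0 he].
exists eta => //= h hd h0.
have lineN t : `|t| <= `|h| -> (E° `&` W) (t *: v + \val x).
  move=> th; apply: he => /=; rewrite sub0r normrN; apply: le_lt_trans th _.
  by move: hd; rewrite /= sub0r normrN.
have lineE t (th : `|t| <= `|h|) := interior_subset (lineN t th).1.
have h_self : `|h| <= `|h| by [].
pose xh : X := exist _ (h *: v + \val x) (mem_set (lineE h h_self)).
have bound y : `|F y xh - F y x - G y x * h| <= e * `|h|.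
  have := @mean_value_bound R (fun t => ext (F y) (t *: v + \val x))
    (fun t => ext (G y) (t *: v + \val x)) h (G y x) e.
  rewrite scale0r add0r extE -[h *: v + _]/(\val xh) extE; apply.
    move=> t th.
    apply: (is_derive_line (ext (F y)) (\val x) v t _).1.
    pose xt : X := exist _ (t *: v + \val x) (mem_set (lineE t th)).
    by rewrite -[t *: v + _]/(\val xt) extE; apply: dF; exact: (lineN t th).1.
  move=> t th.
  pose xt : X := exist _ (t *: v + \val x) (mem_set (lineE t th)).
  rewrite -[t *: v + _]/(\val xt) extE; apply/ltW/(We xt).
  exact: (lineN t th).2.
rewrite /= -[h *: v + _]/(\val xh) !extE /Phi /l.
have -> : \int[mu]_y G y x - h^-1 *: (\int[mu]_y F y xh - \int[mu]_y F y x) =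
    - h^-1 * \int[mu]_y (F y xh - F y x - G y x * h).
  have -> : \int[mu]_y (F y xh - F y x - G y x * h) =
     \int[mu]_y F y xh - \int[mu]_y F y x - h * \int[mu]_y G y x.
    rewrite -integralZ_continuous// -!integralB_continuous//.
    - by apply: eq_Rintegral => y _; rewrite (mulrC h).
    - exact: continuous_sub.
    - exact: continuous_scale.
  by rewrite /GRing.scale /=; field.
rewrite normrM normrN normfV ler_pdivrMl ?normr_gt0// mulrC.
apply: integral_norm_le bound.
apply: continuous_sub; first exact: continuous_sub.
by apply: continuous_mul => //; exact: cst_continuous.
Qed.

Lemma Cs_family_integral s F (mu : P) : Cs_family s F ->
  Cs_family s (fun _ x => \int[mu]_y F y x).
Proof.
have c2 f : continuous f -> continuous2 (fun _ x => f x).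
  exact: (@continuous_snd_comp X X R).
elim: s F => [|s IH] F CF; have [Fc dF] := CF; split.
- exact/c2/integral_continuous2.
- by [].
- exact/c2/integral_continuous2.
move=> i; have [G [dG CG]] := dF i.
exists (fun _ x => \int[mu]_y G y x); split; last exact: IH.
by move=> _; apply: pderiv_integral => //; exact: Cs_family_continuous CG.
Qed.

Lemma row_mx_continuous (n m : nat) :
  continuous (fun z : 'rV[R]_n * 'rV[R]_m => row_mx z.1 z.2).
Proof.
move=> [u v]; apply/cvg_ballP => e e0 /=.
exists (ball u e, ball v e); first by split; exact: nbhsx_ballx.
move=> [u' v'] /= [[_ uu'] [_ vv']]; split => // i j; rewrite !mxE.
by case: splitP => k _; [exact: uu'|exact: vv'].
Qed.

Lemma smooth_pder n (i : 'I_n) (g : 'rV[R]_n -> R) :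
  smooth g -> smooth (fun x => 'D_(delta_mx 0 i) g x).
Proof.
move=> gs k; have := gs (rcons k i).
by rewrite /pder foldr_rcons.
Qed.

(** A partial derivative in the second variable is a partial derivative on the
    product space in a direction of the second block. *)
Lemma smooth_Cs_family (g : 'rV[R]_(d + d) -> R) s : smooth g ->
  Cs_family s (fun y x : X => g (row_mx (\val y) (\val x))).
Proof.
have c2 (f : 'rV[R]_(d + d) -> R) : continuous f ->
    continuous2 (fun y x : X => f (row_mx (\val y) (\val x))).
  move=> fc z.
  apply: (@cvg_comp _ _ _ (fun z : X * X => (\val z.1, \val z.2))
    (fun z => f (row_mx z.1 z.2))).
    exact: (@continuous_prod_map X X _ _ _ _ val_continuous val_continuous z).
  apply: (@cvg_comp _ _ _ (fun z : 'rV[R]_d * 'rV[R]_d => row_mx z.1 z.2) f).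
    exact: row_mx_continuous.
  exact: fc.
elim: s g => [|s IH] g gs; split.
- exact/c2/(gs [::]).1.
- by [].
- exact/c2/(gs [::]).1.
move=> i; exists (fun y x : X => 'D_(delta_mx 0 (rshift d i)) g (row_mx (\val y) (\val x))).
split; last exact: (IH _ (smooth_pder (rshift d i) gs)).
move=> y x Ex.
apply: (is_derive_ext (H := fun z => g (row_mx (\val y) z))) => //.
have [_ dg] := gs [::].
have rowE h : row_mx (\val y) (h *: (delta_mx 0 i : 'rV[R]_d) + \val x) =
    h *: (delta_mx 0 (rshift d i) : 'rV[R]_(d + d)) + row_mx (\val y) (\val x).
  apply/matrixP => u j; rewrite !mxE ord1.
  have [k jk|k jk] := splitP j; rewrite ?mxE.
    rewrite (_ : j == _ = false) ?mulr0 ?add0r//; apply/negbTE/eqP => /(congr1 val) /=.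
    by rewrite jk => kE; have := ltn_ord k; rewrite kE ltnNge leq_addr.
  have -> : j = rshift d k by exact: val_inj.
  by rewrite (inj_eq (@rshift_inj d d)).
have -> : \val x = (0 : R) *: (delta_mx 0 i : 'rV[R]_d) + \val x by rewrite scale0r add0r.
apply: (is_derive_line (fun z => g (row_mx (\val y) z)) _ _ _ _).2.
have := dg (rshift d i) (row_mx (\val y) (\val x)) => /derivableP /=.
set w : 'rV[R]_(d + d) := delta_mx 0 _; set z := row_mx _ _ => dgz.
have zE : z = (0 : R) *: w + z by rewrite scale0r add0r.
rewrite [in is_derive z]zE in dgz.
have := (is_derive_line g z w 0 _).1 dgz.
under eq_fun do rewrite -rowE.
by rewrite scale0r add0r.
Qed.

End IntegralDerivative.

(** * Comparison with the C^s norm *)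

Section Comparison.
Context {R : realType} {d : nat} {a : 'rV[R]_d} {r : {posnum R}}.
Local Notation X := (Xball a r).
Local Notation E := (euclidean_ball a r%:num).
Implicit Types f g : X -> R.

Lemma pder_rcons n (k : seq 'I_n) i (f : 'rV[R]_n -> R) :
  pder (rcons k i) f = pder k (fun x => 'D_(delta_mx 0 i) f x).
Proof. by rewrite /pder foldr_rcons. Qed.

Lemma near_interior (H1 H2 : 'rV[R]_d -> R) x : (forall x, E° x -> H1 x = H2 x) -> E° x ->
  \forall y \near x, H1 y = H2 y.
Proof.
move=> H12 Ex; have : nbhs x E° by exact: open_nbhs_nbhs (conj (open_interior _) Ex).
by apply: filterS => y; exact: H12.
Qed.

Lemma pder_eq_interior (k : seq 'I_d) (H1 H2 : 'rV[R]_d -> R) :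
  (forall x, E° x -> H1 x = H2 x) ->
  forall x, E° x -> pder k H1 x = pder k H2 x.
Proof.
move=> H12; elim: k => //= i k IH x Ex.
by apply: near_eq_derive; exact: near_interior IH Ex.
Qed.

(** In [Dk k f] the last index of [k] is differentiated first, so that the
    recursion of [Cs_ball] peels [k] off from the right. *)
Lemma Dk_rcons k i f g : pderiv i f g ->
  forall x, E° x -> Dk (rcons k i) f x = Dk k g x.
Proof.
move=> dg; rewrite /Dk pder_rcons; apply: pder_eq_interior => x Ex.
pose x' : X := exist _ x (mem_set (interior_subset Ex)).
have := dg x' Ex => -[_ ->].
by rewrite -extE.
Qed.

Lemma Cs_ball_Dk s B f (k : seq 'I_d) : Cs_ball s B f -> (size k <= s)%N ->
  exists2 g, Cs_ball (s - size k) B g & forall x : X, E° (\val x) -> Dk k f (\val x) = g x.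
Proof.
elim/last_ind: k s f => [|k i IH] s f Cf ks.
  by exists f; [rewrite subn0|move=> x _; rewrite -extE].
case: s Cf ks => [|s] Cf; rewrite size_rcons // ltnS => ks.
have [_ _ /(_ i)[f' [df' Cf']]] := Cf.
have [g Cg gE] := IH s f' Cf' ks.
exists g; first by rewrite subSS.
by move=> x Ex; rewrite (Dk_rcons k df')// gE.
Qed.

Lemma Cs_ball_Cs s B f : Cs_ball s B f -> Cs s f.
Proof.
move=> Cf; split; first exact: Cs_ball_continuous Cf.
  move=> k i x ks Ex.
  have [g Cg gE] := Cs_ball_Dk Cf (ltnW ks).
  move: Cg; rewrite -(prednK (n := s - size k)) ?subn_gt0//.
  case=> _ _ /(_ i)[g' [dg' _]].
  pose x' : X := exist _ x (mem_set (interior_subset Ex)).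
  have [dx _] := dg' x' Ex.
  apply: near_eq_derivable dx; apply: (near_interior _ Ex) => y Ey.
  pose y' : X := exist _ y (mem_set (interior_subset Ey)).
  by rewrite -[y]/(\val y') extE gE.
move=> k ks; have [g Cg gE] := Cs_ball_Dk Cf ks.
by exists g => //; exact: Cs_ball_continuous Cg.
Qed.

Lemma Cs_ball_norm_le s B f : Cs_ball s B f -> Cs_norm s f <= s.+1%:R * B.
Proof.
move=> Cf; rewrite /Cs_norm.
have -> : s.+1%:R * B = \sum_(j < s.+1) B by rewrite sumr_const card_ord mulr_natl.
apply: ler_sum => j _; apply/bigmax_leP; split; first exact: Cs_ball_ge0 Cf.
move=> k _; apply: ge_sup.
  exists `|Dk k f a|; exists a => //; apply: open_ball_interior.
  by rewrite big1 ?exprn_gt0// => i _; rewrite subrr expr0n.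
move=> _ [x Ex <-].
have ks : (size k <= s)%N by rewrite size_tuple -ltnS.
have [g Cg gE] := Cs_ball_Dk Cf ks.
pose x' : X := exist _ x (mem_set (interior_subset Ex)).
by rewrite -[x]/(\val x') gE//; exact: Cs_ball_bound Cg _.
Qed.

Lemma Dk_le_norm s f (k : seq 'I_d) x : Cs s f -> (size k <= s)%N -> E° x ->
  `|Dk k f x| <= Cs_norm s f.
Proof.
move=> [fc df ef] ks Ex.
have sup_ge j (l : j.-tuple 'I_d) : (j <= s)%N -> E° `<=` [set y | `|Dk l f y| <=
    sup [set `|Dk l f y| | y in E°]].
  move=> js y Ey; apply: ub_le_sup; last by exists y.
  have [|g gc gE] := ef l; first by rewrite size_tuple.
  have [B _ gB] := bounded_continuous gc.
  exists B => _ [z Ez <-].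
  pose z' : X := exist _ z (mem_set (interior_subset Ez)).
  by rewrite -[z]/(\val z') gE.
have max_ge0 (j : 'I_s.+1) : 0 <= \big[Num.max/0]_(l : j.-tuple 'I_d)
    sup [set `|Dk l f y| | y in E°] by exact: bigmax_ge_id.
rewrite /Cs_norm.
have ks' : (size k < s.+1)%N by [].
rewrite (bigD1 (Ordinal ks'))//=.
apply: (@le_trans _ _ (\big[Num.max/0]_(l : (size k).-tuple 'I_d)
    sup [set `|Dk l f y| | y in E°])); last first.
  by rewrite lerDl; apply: sumr_ge0 => j _; exact: max_ge0.
have -> : Dk k f x = Dk (in_tuple k) f x by [].
apply: le_trans (sup_ge _ (in_tuple k) ks x Ex) _.
exact: (le_bigmax _ (fun l : (size k).-tuple 'I_d => sup [set `|Dk l f y| | y in E°])).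
Qed.

(** The norm only controls the derivatives in the interior; density of the
    interior carries the bounds to the continuous extensions. *)
Lemma Cs_ball_of_norm s B f : Cs s f -> Cs_norm s f <= B -> Cs_ball s B f.
Proof.
move=> Cf fB.
have : forall k : seq 'I_d, (size k <= s)%N -> forall x, E° x -> `|Dk k f x| <= B.
  by move=> k ks x Ex; exact: le_trans (Dk_le_norm Cf ks Ex) fB.
elim: s f Cf {fB} => [|s IH] f Cf DB; have [fc df ef] := Cf.
  split => //; apply: interior_bound => // x Ex.
  by have := DB [::] isT _ Ex; rewrite -extE.
split => //.
  apply: interior_bound => // x Ex.
  by have := DB [::] isT _ Ex; rewrite -extE.
move=> i; have [g gc gE] := ef [:: i] isT.
have dg : pderiv i f g.
  move=> x Ex; rewrite -gE//; apply/derivableP.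
  exact: (df [::] i).
exists g; split => //; apply: IH.
  split => //.
    move=> k j x ks Ex.
    have := df (rcons k i) j x; rewrite size_rcons => /(_ ks Ex).
    by apply: near_eq_derivable; apply: near_interior Ex; exact: Dk_rcons.
  move=> k ks; have [|h hc hE] := ef (rcons k i); first by rewrite size_rcons.
  exists h => // x Ex; rewrite -hE//.
  by rewrite (Dk_rcons k dg).
move=> k ks x Ex; rewrite -(Dk_rcons k dg)//.
by apply: DB => //; rewrite size_rcons.
Qed.

End Comparison.

(** * The linearized system *)

Section Markov.
Context {R : realType} {d : nat} {a : 'rV[R]_d} {r : {posnum R}}.
Local Notation X := (Xball a r).
Local Notation P := (probability (borelX a r) R).
Implicit Types (p : X -> X -> R) (f q : X -> R) (mu : P).

(** One row of the system: [eps] times the derivative of the integral equation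
    in [x] with respect to the potentials. The other row has the transposed density and the
    other marginal. *)
Definition linearized_op p mu (q1 q2 : X -> R) (x : X) : R :=
  q1 x + \int[mu]_y (p x y * q2 y).

Lemma continuous2_section p x : continuous2 p -> continuous (p x).
Proof. exact: (@continuous_sectionr X X R _ x). Qed.

(** Doeblin's argument: [p - delta] is nonnegative of mass [1 - delta], and the
    part [delta] of the density does not depend on [x], hence cancels in the
    difference. *)
Lemma markov_contraction p mu (delta M : R) f :
  continuous2 p -> (forall x y, delta <= p x y) ->
  (forall x, \int[mu]_y p x y = 1) -> continuous f ->
  (forall y y', `|f y - f y'| <= M) ->
  forall x x', `|\int[mu]_y (p x y * f y) - \int[mu]_y (p x' y * f y)|
    <= (1 - delta) * M.
Proof.
move=> pc pd p1 fc fM.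
pose m := inf (range f).
have [B _ fB] := bounded_continuous fc.
have lbf : has_lbound (range f).
  exists (- B) => _ [y _ <-]; have := fB y; rewrite ler_norml => /andP[] //.
have mf y : m <= f y by apply: ge_inf => //; exists y.
have fmM y : f y <= m + M.
  rewrite -lerBlDr; apply: lb_le_inf; first by exists (f point); exists point.
  move=> _ [y' _ <-]; have := le_trans (ler_norm _) (fM y y').
  by rewrite lerBlDr -lerBlDl.
have pcx x := continuous2_section (x := x) pc.
have fmc : continuous (fun y => f y - m).
  by apply: continuous_sub => //; exact: cst_continuous.
have pdc x : continuous (fun y => p x y - delta).
  by apply: continuous_sub => //; exact: cst_continuous.
pose D x := \int[mu]_y ((p x y - delta) * (f y - m)).
have DE x : \int[mu]_y (p x y * f y) = D x + m + delta * \int[mu]_y (f y - m).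
  have -> : \int[mu]_y (p x y * f y) =
      \int[mu]_y ((p x y - delta) * (f y - m) + m * p x y + delta * (f y - m)).
    by apply: eq_Rintegral => y _; ring.
  have c1 : continuous (fun y => (p x y - delta) * (f y - m)) by exact: continuous_mul.
  have c2 : continuous (fun y => m * p x y) by exact: continuous_scale.
  have c3 : continuous (fun y => delta * (f y - m)) by exact: continuous_scale.
  have c12 : continuous (fun y => (p x y - delta) * (f y - m) + m * p x y).
    exact: continuous_add.
  rewrite (integralD_continuous mu c12 c3) (integralD_continuous mu c1 c2).
  by rewrite !integralZ_continuous// p1 mulr1.
have D0 x : 0 <= D x.
  by apply: Rintegral_ge0 => y _; rewrite mulr_ge0// subr_ge0.
have DM x : D x <= (1 - delta) * M.
  have -> : (1 - delta) * M = \int[mu]_y (M * (p x y - delta)).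
    rewrite integralZ_continuous// integralB_continuous//; last exact: cst_continuous.
    by rewrite p1 integral_probability_cst mulrC.
  apply: integral_continuous_le.
  - exact: continuous_mul.
  - exact: continuous_scale.
  - by move=> y; rewrite mulrC ler_wpM2r ?subr_ge0// lerBlDl.
move=> x x'; rewrite !DE.
rewrite (_ : _ - _ = D x - D x'); last by ring.
have := D0 x; have := D0 x'; have := DM x; have := DM x'.
by rewrite ler_norml => ? ? ? ?; apply/andP; split; lra.
Qed.

(** Subtracting the equations at two points, [markov_contraction] bounds the
    oscillation M of the pair by [2 F + (1 - delta) M]; the normalization then
    fixes the additive constant (c, - c) that the two equations leave free. *)
Lemma linearized_system_bound p mu1 mu2 (delta F : R) q1 q2 (x1o x2o : X) :
  continuous2 p -> continuous2 (fun x y => p y x) -> 0 < delta ->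
  (forall x y, delta <= p x y) ->
  (forall x, \int[mu2]_y p x y = 1) -> (forall y, \int[mu1]_x p x y = 1) ->
  continuous q1 -> continuous q2 -> q1 x1o = q2 x2o ->
  (forall x, `|linearized_op p mu2 q1 q2 x| <= F) ->
  (forall y, `|linearized_op (fun x y => p y x) mu1 q2 q1 y| <= F) ->
  forall x, `|q1 x| <= (1 + 3 / delta) * F /\ `|q2 x| <= (1 + 3 / delta) * F.
Proof.
move=> pc pc' d0 pd p2 p1 q1c q2c qo F1 F2.
have F0 : 0 <= F by apply: le_trans (F1 point).
(* One supremum for both components, since the oscillation of each is bounded
   through that of the other. *)
pose S := [set z | exists x x', z = `|q1 x - q1 x'|] `|`
  [set z | exists x x', z = `|q2 x - q2 x'|].
have [B1 _ q1B] := bounded_continuous q1c.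
have [B2 _ q2B] := bounded_continuous q2c.
have Sb : has_ubound S.
  exists (B1 + B1 + (B2 + B2)) => _ [] [x [x' ->]].
    apply: le_trans (ler_normB _ _) _; have := q1B x; have := q1B x'.
    by have := le_trans (normr_ge0 _) (q2B x); lra.
  apply: le_trans (ler_normB _ _) _; have := q2B x; have := q2B x'.
  by have := le_trans (normr_ge0 _) (q1B x); lra.
pose M := sup S.
have M1 x x' : `|q1 x - q1 x'| <= M.
  by apply: ub_le_sup => //; left; exists x, x'.
have M2 x x' : `|q2 x - q2 x'| <= M.
  by apply: ub_le_sup => //; right; exists x, x'.
have M0 : 0 <= M by apply: le_trans (M1 point point).
have step (p' : X -> X -> R) mu (u v : X -> R) x x' : continuous2 p' ->
    (forall x y, delta <= p' x y) -> (forall x, \int[mu]_y p' x y = 1) ->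
    continuous v -> (forall y y', `|v y - v y'| <= M) ->
    (forall x, `|linearized_op p' mu u v x| <= F) ->
    `|u x - u x'| <= F + F + (1 - delta) * M.
  move=> p'c p'd p'1 vc vM uF.
  have := markov_contraction p'c p'd p'1 vc vM x x'.
  have := uF x; have := uF x'; rewrite /linearized_op.
  move: (\int[mu]_y (p' x y * v y)) (\int[mu]_y (p' x' y * v y)) => A A'.
  by rewrite !ler_norml => /andP[? ?] /andP[? ?] /andP[? ?]; apply/andP; split; lra.
have MF : M <= F + F + (1 - delta) * M.
  apply: ge_sup; first by exists `|q1 point - q1 point|; left; exists point, point.
  move=> _ [] [x [x' ->]].
    exact: (step p mu2 q1 q2).
  by apply: (step (fun x y => p y x) mu1 q2 q1).
have Md : M <= 2 * F / delta by rewrite ler_pdivlMr//; lra.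
have A2 : `|\int[mu2]_y (p x1o y * q2 y) - q2 x2o| <= M.
  have -> : \int[mu2]_y (p x1o y * q2 y) - q2 x2o =
      \int[mu2]_y (p x1o y * (q2 y - q2 x2o)).
    have -> : \int[mu2]_y (p x1o y * (q2 y - q2 x2o)) =
        \int[mu2]_y (p x1o y * q2 y - q2 x2o * p x1o y).
      by apply: eq_Rintegral => y _; ring.
    have c := continuous2_section (x := x1o) pc.
    rewrite integralB_continuous ?integralZ_continuous// ?p2 ?mulr1//.
      exact: continuous_mul.
    exact: continuous_scale.
  have c1 : continuous (fun y => p x1o y * (q2 y - q2 x2o)).
    apply: continuous_mul; first exact: continuous2_section.
    by apply: continuous_sub => //; exact: cst_continuous.
  apply: le_trans (le_normr_Rintegral _ (integrable_continuous mu2 c1)) _ => //.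
  rewrite -[leRHS]mulr1 -(p2 x1o) -integralZ_continuous; last first.
    exact: continuous2_section.
  apply: integral_continuous_le.
  - exact: continuous_abs.
  - by apply: continuous_scale; exact: continuous2_section.
  move=> y; have p0 : 0 <= p x1o y by apply: le_trans (pd _ _); exact: ltW.
  by rewrite normrM (ger0_norm p0) mulrC ler_wpM2r.
have fin (u : R) : `|u| <= (F + M) / 2 + M -> `|u| <= (1 + 3 / delta) * F.
  have dn0 : delta != 0 by rewrite gt_eqF.
  have -> : (1 + 3 / delta) * F = F + 3 / 2 * (2 * F / delta) by field.
  by move=> h; lra.
have q1o : `|q1 x1o| <= (F + M) / 2.
  have := F1 x1o; rewrite /linearized_op.
  move: A2; rewrite -qo; move: (\int[mu2]_y _) => A.
  by rewrite !ler_norml => /andP[? ?] /andP[? ?]; apply/andP; split; lra.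
move=> x; split; apply: fin.
  have := M1 x x1o; move: q1o.
  by rewrite !ler_norml => /andP[? ?] /andP[? ?]; apply/andP; split; lra.
have := M2 x x2o; move: q1o; rewrite qo.
by rewrite !ler_norml => /andP[? ?] /andP[? ?]; apply/andP; split; lra.
Qed.

End Markov.

(** * Pairing functionals on the unit ball with C^s functions *)

Section Pairing.
Context {R : realType} {d : nat} {a : 'rV[R]_d} {r : {posnum R}} (s : nat).
Local Notation X := (Xball a r).
Local Notation P := (probability (borelX a r) R).
Local Notation L := (ufun R (@Bs R d a r s)).
Implicit Types (f g : X -> R) (gam : L).

(** A multiple of the norm that brings every C^s function into the unit ball.
    The factor [s.+1] is lost in the comparison of the C^s norm, a sum over the
    orders, with the maximum in [Cs_ball]; adding [1] keeps the scale positive. *)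
Definition pairing_scale f : R := s.+1%:R * (Cs_norm s f + 1).

(** The value at [f] of the homogeneous extension of a functional that is given
    on the unit ball only. *)
Definition pairing gam f : R := pairing_scale f *
  valL_ (0 : R) (A := @Bs R d a r s) gam (fun x => (pairing_scale f)^-1 * f x).

Lemma Cs_ball_self f : Cs s f -> Cs_ball s (Cs_norm s f) f.
Proof. by move=> /Cs_ball_of_norm; apply. Qed.

Lemma pairing_scale_gt0 f : Cs s f -> 0 < pairing_scale f.
Proof.
by move=> Cf; rewrite mulr_gt0// ltr_wpDl//; exact: Cs_ball_ge0 (Cs_ball_self Cf).
Qed.

Lemma pairing_scale_in_Bs f : Cs s f ->
  @Bs R d a r s (fun x => (pairing_scale f)^-1 * f x).
Proof.
move=> Cf; have N0 := pairing_scale_gt0 Cf.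
have Ck := Cs_ballZ (pairing_scale f)^-1 (Cs_ball_self Cf).
split; first exact: Cs_ball_Cs Ck.
apply: le_trans (Cs_ball_norm_le Ck) _.
rewrite gtr0_norm ?invr_gt0// mulrCA mulrC ler_pdivrMr// mul1r.
by rewrite ler_wpM2l// lerDl.
Qed.

Definition rescaled f (Cf : Cs s f) : @Bs R d a r s :=
  exist (fun g => g \in @Bs R d a r s) _ (mem_set (pairing_scale_in_Bs Cf)).

Lemma pairingE gam f (Cf : Cs s f) :
  pairing gam f = pairing_scale f * gam (rescaled Cf).
Proof.
congr (_ * _).
exact: (congr1 (@^~ (rescaled Cf)) (@valLK _ _ (0 : R) (@Bs R d a r s) gam)).
Qed.

(** For a fixed [f] the pairing is continuous in the functional; this is how
    linearity passes from differences of measures to limits. *)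
Lemma pairing_le gam gam' f (e : R) : Cs s f -> ball gam e gam' ->
  `|pairing gam f - pairing gam' f| <= pairing_scale f * e.
Proof.
move=> Cf gg.
rewrite !(pairingE _ Cf) -mulrBr normrM gtr0_norm ?pairing_scale_gt0//.
by rewrite ler_wpM2l ?(ltW (pairing_scale_gt0 Cf))//; exact/ltW/gg.
Qed.

Lemma Cs_continuous f : Cs s f -> continuous f.
Proof. by case. Qed.

Lemma pairing_measure (mu nu : P) (t : R) f : Cs s f ->
  pairing (t *: (emb s nu - emb s mu)) f =
  t * (\int[nu]_x f x - \int[mu]_x f x).
Proof.
move=> Cf; have fc := Cs_continuous Cf.
have N0 := pairing_scale_gt0 Cf.
rewrite (pairingE _ Cf); set u := rescaled Cf.
have -> : (t *: (emb s nu - emb s mu)) u = t * (emb s nu u - emb s mu u) by [].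
rewrite /emb /= !integralZ_continuous// -mulrBr mulrCA mulVKf//.
by rewrite gt_eqF.
Qed.

Record bounded_linear gam (G : R) : Prop := BoundedLinear {
  pairingB : forall f g, Cs s f -> Cs s g ->
    pairing gam (fun x => f x - g x) = pairing gam f - pairing gam g;
  pairingZ : forall k f, Cs s f ->
    pairing gam (fun x => k * f x) = k * pairing gam f;
  pairing_bound : forall f B, Cs_ball s B f -> `|pairing gam f| <= G * B }.

Lemma CsB f g : Cs s f -> Cs s g -> Cs s (fun x => f x - g x).
Proof.
by move=> /Cs_ball_self Cf /Cs_ball_self Cg; exact: Cs_ball_Cs (Cs_ballB Cf Cg).
Qed.

Lemma CsZ k f : Cs s f -> Cs s (fun x => k * f x).
Proof. by move=> /Cs_ball_self Cf; exact: Cs_ball_Cs (Cs_ballZ k Cf). Qed.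

Lemma closure_M_ball (eta : P) gam (e : R) : closure (M_ s eta) gam -> 0 < e ->
  exists2 m, M_ s eta m & ball gam e m.
Proof.
move=> cl e0; have [m [Mm bm]] := cl _ (nbhsx_ballx gam _ e0).
by exists m.
Qed.

Lemma eq_of_small_dist (x y C : R) : (forall e, 0 < e -> `|x - y| <= C * e) -> x = y.
Proof.
move=> h; apply/eqP; rewrite -subr_eq0 -normr_eq0 eq_le normr_ge0 andbT.
apply/ler_addgt0Pr => e e0; rewrite add0r.
have C0 : 0 < `|C| + 1 by rewrite ltr_wpDl.
apply: le_trans (h (e / (`|C| + 1)) _) _; first exact: divr_gt0.
rewrite mulrA ler_pdivrMr// mulrC ler_wpM2l ?(ltW e0)//.
by apply: le_trans (ler_norm _) _; rewrite lerDl.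
Qed.

Lemma closure_pairingB (eta : P) gam f g : closure (M_ s eta) gam ->
  Cs s f -> Cs s g ->
  pairing gam (fun x => f x - g x) = pairing gam f - pairing gam g.
Proof.
move=> cl Cf Cg; have Cfg := CsB Cf Cg.
apply: (@eq_of_small_dist _ _ (pairing_scale (fun x => f x - g x) +
  (pairing_scale f + pairing_scale g))) => e e0.
have [_ [nu [t [_ t0 ->]]]] := closure_M_ball cl e0.
set m := _ *: _ => gm.
have := pairing_le Cf gm; have := pairing_le Cg gm; have := pairing_le Cfg gm.
have -> : pairing m (fun x => f x - g x) = pairing m f - pairing m g.
  rewrite !pairing_measure// !integralB_continuous; try exact: Cs_continuous.
  by ring.
rewrite !mulrDl.
by rewrite !ler_norml => /andP[? ?] /andP[? ?] /andP[? ?]; apply/andP; split; lra.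
Qed.

Lemma closure_pairingZ (eta : P) gam k f : closure (M_ s eta) gam ->
  Cs s f -> pairing gam (fun x => k * f x) = k * pairing gam f.
Proof.
move=> cl Cf; have Ckf := CsZ k Cf.
apply: (@eq_of_small_dist _ _ (pairing_scale (fun x => k * f x) +
  `|k| * pairing_scale f)) => e e0.
have [_ [nu [t [_ t0 ->]]]] := closure_M_ball cl e0.
set m := _ *: _ => gm.
have h1 := pairing_le Cf gm; have h2 := pairing_le Ckf gm.
have mE : pairing m (fun x => k * f x) = k * pairing m f.
  rewrite !pairing_measure// !integralZ_continuous; try exact: Cs_continuous.
  by ring.
rewrite mE in h2.
have -> : pairing gam (fun x => k * f x) - k * pairing gam f =
  (pairing gam (fun x => k * f x) - k * pairing m f) - k * (pairing gam f - pairing m f).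
  by ring.
apply: le_trans (ler_normB _ _) _; rewrite normrM mulrDl lerD//.
by rewrite -mulrA ler_wpM2l.
Qed.

(** The functionals [gam'] are within distance [2] of one [t (nu - eta)], which is
    at most [2 t] on functions bounded by [1]; homogeneity then gives a linear
    bound that is uniform over the ball. *)
Lemma closure_bounded_linear (eta : P) gam : closure (M_ s eta) gam ->
  exists2 G, 0 <= G & forall gam', closure (M_ s eta) gam' -> ball gam 1 gam' ->
    bounded_linear gam' G.
Proof.
move=> cl; have [_ [nu [t [_ t0 ->]]]] := closure_M_ball cl ltr01.
set m := _ *: _ => gm.
pose G : R := t * 2 + s.+1%:R * (s.+1%:R + 1) * 2.
have G0 : 0 <= G by rewrite addr_ge0 ?mulr_ge0 ?(ltW t0)// addr_ge0.
exists G => // gam' cl' gg'; split.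
- by move=> f g; exact: closure_pairingB cl'.
- by move=> k f; exact: closure_pairingZ cl'.
have unit_bound f : Cs_ball s 1 f -> `|pairing gam' f| <= G.
  move=> Cf1; have Cf := Cs_ball_Cs Cf1; have fc := Cs_continuous Cf.
  have mg' : ball m (1 + 1) gam' by apply: ball_triangle gg'; exact: ball_sym.
  have := pairing_le Cf mg'; rewrite pairing_measure//.
  have := integral_norm_le nu fc (Cs_ball_bound Cf1).
  have := integral_norm_le eta fc (Cs_ball_bound Cf1).
  set x := \int[nu]_x f x; set y := \int[eta]_x f x => x1 y1.
  have sc : pairing_scale f <= s.+1%:R * (s.+1%:R + 1).
    rewrite ler_wpM2l// lerD2r.
    by have := Cs_ball_norm_le Cf1; rewrite mulr1.
  move=> h.
  have -> : pairing gam' f = t * (x - y) - (t * (x - y) - pairing gam' f) by ring.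
  apply: le_trans (ler_normB _ _) _; apply: lerD.
    rewrite normrM gtr0_norm// ler_wpM2l ?(ltW t0)//.
    by apply: le_trans (ler_normB _ _) _; exact: lerD.
  by apply: le_trans h _; rewrite ler_wpM2r.
move=> f B CfB; have B0 := Cs_ball_ge0 CfB.
have [B_eq0|Bn0] := eqVneq B 0.
  have -> : f = (fun x => 0 * f x).
    apply/funext => x; rewrite mul0r; apply/eqP; rewrite -normr_le0 -B_eq0.
    exact: Cs_ball_bound CfB x.
  by rewrite (closure_pairingZ _ cl' (Cs_ball_Cs CfB)) mul0r normr0 mulr_ge0.
have Bgt0 : 0 < B by rewrite lt_neqAle eq_sym Bn0.
have := Cs_ballZ B^-1 CfB; rewrite gtr0_norm ?invr_gt0// mulVf// => /unit_bound.
rewrite (closure_pairingZ _ cl' (Cs_ball_Cs CfB)) normrM gtr0_norm ?invr_gt0//.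
by rewrite ler_pdivrMl// mulrC.
Qed.

End Pairing.

(** * Expansion of one equation *)

Section Expansion.
Context {R : realType} {d : nat} {a : 'rV[R]_d} {r : {posnum R}} (s : nat).
Local Notation X := (Xball a r).
Local Notation P := (probability (borelX a r) R).
Local Notation L := (ufun R (@Bs R d a r s)).
Variables (eps : R) (eps0 : 0 < eps) (p : X -> X -> R) (B : R).
Hypothesis pB : forall x, Cs_ball s B (p x).
Implicit Types (h k : X -> R) (mu nu : P) (gam : L).

(** The right-hand side of one row of the system for the second derivative: the
    mixed term of the variation of the measure and of the potentials, and the
    quadratic term in the potentials. *)
Definition second_order mu gam h1 h2 (x : X) : R :=
  - 2 * pairing gam (fun y => p x y * (h1 x + h2 y)) -
  eps^-1 * \int[mu]_y (p x y * ((h1 x + h2 y) * (h1 x + h2 y))).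

Lemma Cs_ball_add_cst (H c : R) h : `|c| <= H -> Cs_ball s H h ->
  Cs_ball s (H + H) (fun y => c + h y).
Proof. by move=> cH Ch; apply: Cs_ballD Ch; apply: Cs_ball_le (Cs_ball_cst _ _). Qed.

Lemma Cs_ball_kernel_mul (A : R) x h : Cs_ball s A h ->
  Cs_ball s (2 ^+ s * (B * A)) (fun y => p x y * h y).
Proof. by move=> Ch; exact: Cs_ballM. Qed.

Lemma norm_div_le (u v k : R) : `|u| <= v -> `|u / k| <= `|v / k|.
Proof.
by move=> uv; rewrite !normrM ler_wpM2r// (le_trans uv)// ler_norm.
Qed.

(** The integral equation at [nu] is expanded to third order in
    [z = t (h1 x + h2 y) / eps]. The difference [nu - mu = t gam] is tested on
    [p], [p z] and [p z ^+ 2] only, whose C^s norms are controlled; in the cubic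
    remainder it is enough to use that [nu] is a probability. *)
Lemma third_order_expansion (G H : R) : 0 <= G -> exists2 C : R, 0 <= C &
  forall mu nu (t : R) gam h1 h2,
  0 < t -> (H + H) * t <= eps ->
  gam = t^-1 *: (emb s nu - emb s mu) -> bounded_linear gam G ->
  Cs_ball s H h1 -> Cs_ball s H h2 ->
  (forall x, \int[mu]_y p x y = 1) ->
  (forall x, \int[nu]_y (p x y * expR (t / eps * (h1 x + h2 y))) = 1) ->
  forall x,
  `| eps^-1 * \int[mu]_y (p x y * (h1 x + h2 y)) + pairing gam (p x) +
     t / eps * pairing gam (fun y => p x y * (h1 x + h2 y)) +
     t / (2 * eps ^+ 2) *
       \int[mu]_y (p x y * ((h1 x + h2 y) * (h1 x + h2 y))) | <= C * t ^+ 2.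
Proof.
move=> G0.
pose C2 : R := 2 ^+ s * (B * (2 ^+ s * ((H + H) * (H + H)))).
have B0 : 0 <= B := Cs_ball_ge0 (pB point).
pose C : R := `|G * C2 / (2 * eps ^+ 2)| + `|B * expR 1 * ((H + H) / eps) ^+ 3|.
exists C; first by rewrite addr_ge0.
move=> mu nu t gam h1 h2 t0 Ht gamE Lg Ch1 Ch2 mu1 nu1 x.
have H0 : 0 <= H := Cs_ball_ge0 Ch1.
pose w y := h1 x + h2 y.
have Cw : Cs_ball s (H + H) w by apply: Cs_ball_add_cst => //; exact: Cs_ball_bound Ch1 x.
have Cw2 := Cs_ballM Cw Cw.
have Cpw := Cs_ball_kernel_mul x Cw; have Cpw2 := Cs_ball_kernel_mul x Cw2.
have wc := Cs_ball_continuous Cw; have pc := Cs_ball_continuous (pB x).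
have pwc := Cs_ball_continuous Cpw; have pw2c := Cs_ball_continuous Cpw2.
have diff f : Cs s f -> \int[nu]_y f y = \int[mu]_y f y + t * pairing gam f.
  move=> Cf; rewrite gamE pairing_measure// mulVKf ?gt_eqF//; ring.
set z := fun y => t / eps * w y.
have zc : continuous z by exact: continuous_scale.
have z1 y : `|z y| <= 1.
  rewrite /z normrM gtr0_norm ?divr_gt0// mulrAC ler_pdivrMr// mul1r.
  by apply: le_trans Ht; rewrite mulrC ler_wpM2r ?(ltW t0)//; exact: Cs_ball_bound Cw y.
pose rho y := expR (z y) - 1 - z y - z y ^+ 2 / 2.
have rhoc : continuous rho.
  apply: continuous_sub; last first.
    apply: continuous_mul; first exact: continuous_expn.
    exact: cst_continuous.
  apply: continuous_sub => //; apply: continuous_sub; last exact: cst_continuous.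
  exact: continuous_exp.
have prc : continuous (fun y => p x y * rho y) by exact: continuous_mul.
pose rb := \int[nu]_y (p x y * rho y).
have rhoE : 1 = \int[nu]_y p x y + t / eps * \int[nu]_y (p x y * w y) +
    t ^+ 2 / (2 * eps ^+ 2) * \int[nu]_y (p x y * (w y * w y)) + rb.
  rewrite -[LHS](nu1 x).
  have c1 : continuous (fun y => t / eps * (p x y * w y)) := continuous_scale pwc.
  have c2 : continuous (fun y => t ^+ 2 / (2 * eps ^+ 2) * (p x y * (w y * w y))) :=
    continuous_scale pw2c.
  have c3 := continuous_add pc c1; have c4 := continuous_add c3 c2.
  rewrite -(integralZ_continuous nu (t / eps) pwc).
  rewrite -(integralZ_continuous nu (t ^+ 2 / (2 * eps ^+ 2)) pw2c).
  rewrite -(integralD_continuous nu pc c1) -(integralD_continuous nu c3 c2).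
  rewrite -(integralD_continuous nu c4 prc).
  apply: eq_Rintegral => y _; rewrite /rho /z -/(w y).
  by field; rewrite gt_eqF.
have rbB : `|rb| <= B * expR 1 * ((H + H) / eps) ^+ 3 * t ^+ 3.
  have -> : B * expR 1 * ((H + H) / eps) ^+ 3 * t ^+ 3 =
    B * (expR 1 * ((H + H) / eps * t) ^+ 3).
    by rewrite [((H + H) / eps * t) ^+ 3]exprMn !mulrA.
  apply: integral_norm_le => // y; rewrite normrM ler_pM//.
    exact: Cs_ball_bound (pB x) y.
  apply: le_trans (expR_taylor2 (z1 y)) _; rewrite ler_wpM2l ?expR_ge0//.
  rewrite lerXn2r ?nnegrE// ?mulr_ge0 ?addr_ge0 ?invr_ge0 ?(ltW eps0) ?(ltW t0)//.
  rewrite /z normrM gtr0_norm ?divr_gt0// mulrC -mulrA [_^-1 * t]mulrC ler_wpM2r//.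
    by rewrite divr_ge0 ?ltW.
  exact: Cs_ball_bound Cw y.
rewrite -/(w _) (_ : (fun y => p x y * (h1 x + h2 y)) = fun y => p x y * w y)//.
have Cp := Cs_ball_Cs (pB x).
move: rhoE; rewrite (diff _ Cp) (diff _ (Cs_ball_Cs Cpw)) (diff _ (Cs_ball_Cs Cpw2)) mu1.
have := pairing_bound Lg Cpw2; rewrite -/C2.
set g0 := pairing gam (p x).
set g1 := pairing gam (fun y => p x y * w y).
set g2 := pairing gam (fun y => p x y * (w y * w y)).
rewrite -/(\int[mu]_y (p x y * w y)) => g2B rhoE.
set i1 := \int[mu]_y (p x y * w y) in rhoE *.
set i2 := \int[mu]_y (p x y * (w y * w y)) in rhoE *.
have -> : eps^-1 * i1 + g0 + t / eps * g1 + t / (2 * eps ^+ 2) * i2 =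
    - (t ^+ 2 * (g2 / (2 * eps ^+ 2)) + t^-1 * rb).
  have -> : rb = 1 - (1 + t * g0 + t / eps * (i1 + t * g1) +
     t ^+ 2 / (2 * eps ^+ 2) * (i2 + t * g2)) by lra.
  by field; rewrite !gt_eqF.
rewrite normrN; apply: le_trans (ler_normD _ _) _; rewrite [leRHS]mulrDl; apply: lerD.
  rewrite normrM (ger0_norm (sqr_ge0 t)) mulrC ler_wpM2r ?sqr_ge0//.
  exact: norm_div_le.
rewrite normrM gtr0_norm ?invr_gt0// ler_pdivrMl//.
rewrite mulrCA -exprS; apply: le_trans rbB _.
rewrite ler_wpM2r ?exprn_ge0 ?(ltW t0)//.
exact: ler_norm.
Qed.

(** The terms of order [t] of [third_order_expansion] are absorbed in the error. *)
Lemma first_order (G H : R) : 0 <= G -> exists2 C : R, 0 <= C &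
  forall mu nu (t : R) gam h1 h2,
  0 < t -> t <= 1 -> (H + H) * t <= eps ->
  gam = t^-1 *: (emb s nu - emb s mu) -> bounded_linear gam G ->
  Cs_ball s H h1 -> Cs_ball s H h2 ->
  (forall x, \int[mu]_y p x y = 1) ->
  (forall x, \int[nu]_y (p x y * expR (t / eps * (h1 x + h2 y))) = 1) ->
  forall x,
  `| eps^-1 * \int[mu]_y (p x y * (h1 x + h2 y)) + pairing gam (p x) | <= C * t.
Proof.
move=> G0; have [C C0 hC] := third_order_expansion H G0.
have B0 : 0 <= B := Cs_ball_ge0 (pB point).
pose C1 : R := `|G * (2 ^+ s * (B * (H + H))) / eps|.
pose C2 : R := `|B * ((H + H) * (H + H)) / (2 * eps ^+ 2)|.
exists (C + C1 + C2); first by rewrite !addr_ge0// normr_ge0.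
move=> mu nu t gam h1 h2 t0 t1 Ht gamE Lg Ch1 Ch2 mu1 nu1 x.
have := hC _ _ _ _ _ _ t0 Ht gamE Lg Ch1 Ch2 mu1 nu1 x.
have H0 : 0 <= H := Cs_ball_ge0 Ch1.
have Cw : Cs_ball s (H + H) (fun y => h1 x + h2 y).
  by apply: Cs_ball_add_cst => //; exact: Cs_ball_bound Ch1 x.
have Cpw := Cs_ball_kernel_mul x Cw.
have g1B := pairing_bound Lg Cpw.
have i2B : `|\int[mu]_y (p x y * ((h1 x + h2 y) * (h1 x + h2 y)))| <=
    B * ((H + H) * (H + H)).
  apply: integral_norm_le.
    exact: Cs_ball_continuous (Cs_ball_kernel_mul x (Cs_ballM Cw Cw)).
  move=> y; rewrite !normrM; apply: ler_pM.
  - exact: normr_ge0.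
  - by rewrite mulr_ge0.
  - exact: Cs_ball_bound (pB x) y.
  - by apply: ler_pM => //; exact: Cs_ball_bound Cw y.
set g1 := pairing gam _ in g1B *; set i2 := \int[mu]_y _ in i2B *.
set z := eps^-1 * _ + _ => zB.
have -> : z = (z + t / eps * g1 + t / (2 * eps ^+ 2) * i2) -
   (t * (g1 / eps) + t * (i2 / (2 * eps ^+ 2))) by field; rewrite gt_eqF.
rewrite -[C + C1 + C2]addrA.
apply: le_trans (ler_normB _ _) _; rewrite [leRHS]mulrDl; apply: lerD.
  apply: le_trans zB _; rewrite expr2 mulrA ler_piMr//.
  by rewrite mulr_ge0// ltW.
apply: le_trans (ler_normD _ _) _; rewrite [leRHS]mulrDl; apply: lerD.
  rewrite normrM gtr0_norm// mulrC ler_wpM2r ?(ltW t0)//.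
  exact: norm_div_le.
rewrite normrM gtr0_norm// mulrC ler_wpM2r ?(ltW t0)//.
exact: norm_div_le.
Qed.

(** If [k] solves the equation of first order, subtracting it from
    [third_order_expansion] and multiplying by [2 eps / t] leaves
    an equation for [2 / t (h - k)]. *)
Lemma second_order_expansion (G H : R) : 0 <= G -> exists2 C : R, 0 <= C &
  forall mu nu (t : R) gam h1 h2 k1 k2,
  0 < t -> (H + H) * t <= eps ->
  gam = t^-1 *: (emb s nu - emb s mu) -> bounded_linear gam G ->
  Cs_ball s H h1 -> Cs_ball s H h2 ->
  (forall x, \int[mu]_y p x y = 1) ->
  (forall x, \int[nu]_y (p x y * expR (t / eps * (h1 x + h2 y))) = 1) ->
  continuous k2 ->
  (forall x, eps^-1 * \int[mu]_y (p x y * (k1 x + k2 y)) + pairing gam (p x) = 0) ->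
  forall x,
  `| linearized_op p mu (fun x => 2 / t * (h1 x - k1 x))
       (fun x => 2 / t * (h2 x - k2 x)) x
     - second_order mu gam h1 h2 x| <= C * t.
Proof.
move=> G0; have [C C0 hC] := third_order_expansion H G0.
exists (2 * eps * C); first by rewrite !mulr_ge0// ltW.
move=> mu nu t gam h1 h2 k1 k2 t0 Ht gamE Lg Ch1 Ch2 mu1 nu1 k2c Dk x.
have := hC _ _ _ _ _ _ t0 Ht gamE Lg Ch1 Ch2 mu1 nu1 x.
have pc := Cs_ball_continuous (pB x); have h2c := Cs_ball_continuous Ch2.
have integral_sum (u : X -> R) : continuous u -> forall c,
    \int[mu]_y (p x y * (c + u y)) = c + \int[mu]_y (p x y * u y).
  move=> uc c; rewrite -[X in _ = X + _]mulr1 -(mu1 x).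
  rewrite -integralZ_continuous// -integralD_continuous.
  - by apply: eq_Rintegral => y _; ring.
  - exact: continuous_scale.
  - exact: continuous_mul.
have c1 : continuous (fun y => p x y * h2 y) by exact: continuous_mul.
have c2 : continuous (fun y => p x y * k2 y) by exact: continuous_mul.
have := Dk x; rewrite !integral_sum// /linearized_op /second_order.
have -> : \int[mu]_y (p x y * (2 / t * (h2 y - k2 y))) =
    2 / t * (\int[mu]_y (p x y * h2 y) - \int[mu]_y (p x y * k2 y)).
  rewrite -(integralB_continuous mu c1 c2) -integralZ_continuous.
    by apply: eq_Rintegral => y _; ring.
  exact: continuous_sub.
set i2 := \int[mu]_y (p x y * (_ * _)).
set g1 := pairing gam (fun y => p x y * (h1 x + h2 y)).
move: (\int[mu]_y (p x y * h2 y)) (\int[mu]_y (p x y * k2 y)) (pairing gam (p x)).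
move=> ih ik g0 Dkx; set z := (X in `|X| <= _) => zB.
have -> : 2 / t * (h1 x - k1 x) + 2 / t * (ih - ik) -
   (- 2 * g1 - eps^-1 * i2) = 2 * eps / t * z.
  have g0E : g0 = - (eps^-1 * (k1 x + ik)) by lra.
  by rewrite /z g0E; field; rewrite !gt_eqF.
rewrite normrM gtr0_norm ?divr_gt0 ?mulr_gt0//.
rewrite mulrAC ler_pdivrMr// -!mulrA ler_wpM2l// ler_wpM2l ?(ltW eps0)//.
Qed.

(** The difference splits into a variation of the function tested against [gam],
    a variation of the functional, and a difference of squares under the
    integral. *)
Lemma second_order_lipschitz (G H : R) : 0 <= G -> 0 <= H ->
  exists2 C : R, 0 <= C &
  forall mu gam gam' h1 h2 h1' h2' (e : R), 0 < e ->
  bounded_linear gam G -> ball gam e gam' ->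
  Cs_ball s H h1 -> Cs_ball s H h2 -> Cs_ball s H h1' -> Cs_ball s H h2' ->
  Cs_ball s e (fun x => h1 x - h1' x) -> Cs_ball s e (fun x => h2 x - h2' x) ->
  forall x, `|second_order mu gam h1 h2 x - second_order mu gam' h1' h2' x| <= C * e.
Proof.
move=> G0 H0; have B0 : 0 <= B := Cs_ball_ge0 (pB point).
pose C1 : R := G * (2 ^+ s * (B * 2)).
pose C2 : R := s.+1%:R * (s.+1%:R * (2 ^+ s * (B * (H + H))) + 1).
pose C3 : R := eps^-1 * (B * (2 * ((H + H) + (H + H)))).
have C10 : 0 <= C1 by rewrite !mulr_ge0// exprn_ge0.
have C20 : 0 <= C2 by rewrite !(mulr_ge0, addr_ge0)// exprn_ge0.
have C30 : 0 <= C3 by rewrite mulr_ge0 ?invr_ge0 ?(ltW eps0)// !(mulr_ge0, addr_ge0).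
exists (2 * C1 + 2 * C2 + C3); first by rewrite !addr_ge0// mulr_ge0.
move=> mu gam gam' h1 h2 h1' h2' e e0 Lg gg' Ch1 Ch2 Ch1' Ch2' Cd1 Cd2 x.
pose w y := h1 x + h2 y; pose w' y := h1' x + h2' y.
have Cw : Cs_ball s (H + H) w by apply: Cs_ball_add_cst => //; exact: Cs_ball_bound Ch1 x.
have Cw' : Cs_ball s (H + H) w' by apply: Cs_ball_add_cst => //; exact: Cs_ball_bound Ch1' x.
have Cww' : Cs_ball s (e + e) (fun y => w y - w' y).
  have := Cs_ball_add_cst (Cs_ball_bound Cd1 x) Cd2.
  by congr Cs_ball; apply/funext => y; rewrite /w /w'; ring.
have Cpw := Cs_ball_kernel_mul x Cw; have Cpw' := Cs_ball_kernel_mul x Cw'.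
have Cpd := Cs_ball_kernel_mul x Cww'.
have gd : `|pairing gam (fun y => p x y * w y) - pairing gam (fun y => p x y * w' y)|
    <= C1 * e.
  rewrite -(pairingB Lg (Cs_ball_Cs Cpw) (Cs_ball_Cs Cpw')).
  have -> : (fun y => p x y * w y - p x y * w' y) = (fun y => p x y * (w y - w' y)).
    by apply/funext => y; rewrite mulrBr.
  apply: le_trans (pairing_bound Lg Cpd) _.
  by rewrite /C1 le_eqVlt; apply/orP; left; apply/eqP; ring.
have gd' : `|pairing gam (fun y => p x y * w' y) - pairing gam' (fun y => p x y * w' y)|
    <= C2 * e.
  apply: le_trans (pairing_le (Cs_ball_Cs Cpw') gg') _; rewrite ler_wpM2r ?(ltW e0)//.
  by rewrite ler_wpM2l// lerD2r; exact: Cs_ball_norm_le.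
have c1 := Cs_ball_continuous (Cs_ball_kernel_mul x (Cs_ballM Cw Cw)).
have c2 := Cs_ball_continuous (Cs_ball_kernel_mul x (Cs_ballM Cw' Cw')).
have id : `|eps^-1 * (\int[mu]_y (p x y * (w y * w y)) -
    \int[mu]_y (p x y * (w' y * w' y)))| <= C3 * e.
  rewrite -integralB_continuous// normrM gtr0_norm ?invr_gt0// /C3 -mulrA.
  rewrite ler_wpM2l ?invr_ge0 ?(ltW eps0)//; apply: integral_norm_le.
    exact: continuous_sub.
  move=> y; have -> : p x y * (w y * w y) - p x y * (w' y * w' y) =
    p x y * ((w y - w' y) * (w y + w' y)) by ring.
  have -> : B * (2 * (H + H + (H + H))) * e = B * ((e + e) * (H + H + (H + H))) by ring.
  rewrite !normrM ler_pM ?mulr_ge0//; first exact: Cs_ball_bound (pB x) y.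
  rewrite ler_pM//; first exact: Cs_ball_bound Cww' y.
  apply: le_trans (ler_normD _ _) _.
  by apply: lerD; [exact: Cs_ball_bound Cw y|exact: Cs_ball_bound Cw' y].
rewrite /second_order -/(w _).
set A := pairing gam _ in gd *; set A' := pairing gam _ in gd gd' *.
set A'' := pairing gam' _ in gd' *.
set I1 := \int[mu]_y _ in id *; set I2 := \int[mu]_y _ in id *.
have -> : - 2 * A - eps^-1 * I1 - (- 2 * A'' - eps^-1 * I2) =
  - (2 * (A - A') + 2 * (A' - A'') + eps^-1 * (I1 - I2)) by ring.
rewrite normrN; apply: le_trans (ler_normD _ _) _; rewrite [leRHS]mulrDl lerD//.
apply: le_trans (ler_normD _ _) _; rewrite [leRHS]mulrDl !normrM (ger0_norm (ler0n _ 2)).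
by apply: lerD; rewrite -mulrA ler_wpM2l.
Qed.

End Expansion.

(** * Smoothness of the density *)

Section Kernel.
Context {R : realType} {d : nat} {a : 'rV[R]_d} {r : {posnum R}}.
Local Notation X := (Xball a r).
Local Notation P := (probability (borelX a r) R).
Variables (eps : R) (c : 'rV[R]_d -> 'rV[R]_d -> R).
Hypothesis c_smooth :
  smooth (fun z : 'rV[R]_(d + d) => c (lsubmx z) (rsubmx z)).
Implicit Types (f g : X -> R) (mu : P).

Definition gibbs f g (y x : X) : R :=
  expR ((f y + g x - c (\val y) (\val x)) / eps).

(** By the integral equation, [expR (g / eps)] is the inverse of an integral in
    [y] of a kernel that is smooth in [x]; hence it is smooth although [g] is
    only assumed to satisfy the equation. The factor [expR (f / eps)] depends on
    the other variable and only has to be continuous. *)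
Lemma gibbs_Cs_family s f g mu : continuous f ->
  (forall x, \int[mu]_y gibbs f g y x = 1) -> Cs_family s (gibbs f g).
Proof.
move=> fc fg1.
pose K (y x : X) := expR (- eps^-1 * c (\val y) (\val x)) : R.
pose u y := expR (f y / eps) : R.
pose v x := expR (g x / eps) : R.
have gE y x : gibbs f g y x = u y * v x * K y x.
  by rewrite /gibbs /u /v /K -!expRD; congr expR; ring.
have CK : Cs_family s K.
  apply: Cs_family_exp; apply: Cs_familyM.
    by apply: Cs_family_param; exact: cst_continuous.
  have := smooth_Cs_family (a := a) (r := r) s c_smooth.
  by under eq_fun do under eq_fun do rewrite row_mxKl row_mxKr.
have uc : continuous u.
  apply: continuous_exp; apply: continuous_mul => //; exact: cst_continuous.
have CuK : Cs_family s (fun y x => u y * K y x).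
  by apply: Cs_familyM => //; exact: Cs_family_param.
have Cint := Cs_family_integral mu CuK.
have vI x : v x * \int[mu]_y (u y * K y x) = 1.
  rewrite -(fg1 x) -integralZ_continuous; last exact: Cs_family_continuousl CuK.
  by apply: eq_Rintegral => y _; rewrite gE; ring.
have I0 x : \int[mu]_y (u y * K y x) != 0.
  by apply: contra_eq_neq (vI x) => ->; rewrite mulr0 eq_sym oner_eq0.
have vE x : v x = (\int[mu]_y (u y * K y x))^-1.
  by rewrite -[LHS]mulr1 -(mulfV (I0 x)) mulrA vI mul1r.
have -> : gibbs f g = fun y x => u y * (\int[mu]_y (u y * K y x))^-1 * K y x.
  by apply/funext => y; apply/funext => x; rewrite gE vE.
apply: Cs_familyM => //; apply: Cs_familyM; first exact: Cs_family_param.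
by apply: Cs_family_inv => // _ x; exact: I0.
Qed.

Lemma Cs_family_lower_bound s (F : X -> X -> R) :
  Cs_family s F -> (forall y x, 0 < F y x) ->
  exists2 delta, 0 < delta & forall y x, delta <= F y x.
Proof.
move=> CF F0.
have [|B B0 FB] := bounded_continuous2 (Cs_family_continuous (Cs_family_inv _ CF)).
  by move=> y x; rewrite gt_eqF.
exists B^-1; first by rewrite invr_gt0.
move=> y x; rewrite -[leRHS]invrK lef_pV2 ?posrE ?invr_gt0//.
exact: le_trans (ler_norm _) (FB y x).
Qed.

End Kernel.

(** * Approximate and exact solutions *)

Section NearSolution.
Context {R : realType} {d : nat} {a : 'rV[R]_d} {r : {posnum R}}.
Local Notation X := (Xball a r).
Local Notation P := (probability (borelX a r) R).
Implicit Types (q f : X -> R).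
Variables (p : X -> X -> R) (mu1 mu2 : P) (delta : R) (x1o x2o : X).
Local Notation pT := (fun x y => p y x).
Hypotheses (pc : continuous2 p) (pTc : continuous2 pT).
Hypotheses (delta0 : 0 < delta) (pd : forall x y, delta <= p x y).
Hypotheses (p2 : forall x, \int[mu2]_y p x y = 1)
  (p1 : forall y, \int[mu1]_x p x y = 1).

(** Approximate solutions are what the difference quotients along a path and
    the exact solutions for neighboring directions provide. *)
Definition near_solution (F1 F2 : X -> R) (q1 q2 : X -> R) (e : R) : Prop :=
  [/\ continuous q1, continuous q2, q1 x1o = q2 x2o,
    (forall x, `|linearized_op p mu2 q1 q2 x - F1 x| <= e) &
    (forall y, `|linearized_op pT mu1 q2 q1 y - F2 y| <= e)].

Definition solution_const : R := 1 + 3 / delta.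
Local Notation K := solution_const.

Lemma solution_const_ge0 : 0 <= K.
Proof. by rewrite addr_ge0// divr_ge0// ltW. Qed.

Lemma linearized_opB (p' : X -> X -> R) (mu : P) u v u' v' x : continuous2 p' ->
  continuous v -> continuous v' ->
  linearized_op p' mu (fun x => u x - u' x) (fun y => v y - v' y) x =
  linearized_op p' mu u v x - linearized_op p' mu u' v' x.
Proof.
move=> p'c vc v'c; rewrite /linearized_op.
have c1 : continuous (fun y => p' x y * v y).
  by apply: continuous_mul => //; exact: continuous2_section.
have c2 : continuous (fun y => p' x y * v' y).
  by apply: continuous_mul => //; exact: continuous2_section.
have -> : \int[mu]_y (p' x y * (v y - v' y)) =
    \int[mu]_y (p' x y * v y) - \int[mu]_y (p' x y * v' y).
  by rewrite -integralB_continuous//; apply: eq_Rintegral => y _; rewrite mulrBr.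
by ring.
Qed.

Lemma near_solution_close F1 F2 F1' F2' q1 q2 q1' q2' e e' eta :
  near_solution F1 F2 q1 q2 e -> near_solution F1' F2' q1' q2' e' ->
  (forall x, `|F1 x - F1' x| <= eta) -> (forall x, `|F2 x - F2' x| <= eta) ->
  forall x, `|q1 x - q1' x| <= K * (e + e' + eta) /\
            `|q2 x - q2' x| <= K * (e + e' + eta).
Proof.
move=> [q1c q2c qo S1 S2] [q1c' q2c' qo' S1' S2'] F1e F2e.
apply: (@linearized_system_bound _ _ _ _ p mu1 mu2 delta _ _ _ x1o x2o) => //.
- exact: continuous_sub.
- exact: continuous_sub.
- by rewrite qo qo'.
- move=> x; rewrite linearized_opB//.
  have := S1 x; have := S1' x; have := F1e x.
  by rewrite !ler_norml => /andP[? ?] /andP[? ?] /andP[? ?]; apply/andP; split; lra.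
- move=> x; rewrite linearized_opB//.
  have := S2 x; have := S2' x; have := F2e x.
  by rewrite !ler_norml => /andP[? ?] /andP[? ?] /andP[? ?]; apply/andP; split; lra.
Qed.

Lemma markov_norm_le (p' : X -> X -> R) (mu : P) f (e : R) x : continuous2 p' ->
  (forall x y, 0 <= p' x y) -> (forall x, \int[mu]_y p' x y = 1) ->
  continuous f -> (forall y, `|f y| <= e) -> `|\int[mu]_y (p' x y * f y)| <= e.
Proof.
move=> p'c p'0 p'1 fc fe.
have px := continuous2_section (x := x) p'c.
have c1 : continuous (fun y => p' x y * f y) by exact: continuous_mul.
apply: le_trans (le_normr_Rintegral _ (integrable_continuous mu c1)) _ => //.
rewrite -[leRHS]mulr1 -(p'1 x) -integralZ_continuous//.
apply: integral_continuous_le.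
- exact: continuous_abs.
- exact: continuous_scale.
- by move=> y; rewrite normrM (ger0_norm (p'0 _ _)) mulrC ler_wpM2r.
Qed.

Lemma uniform_limit_continuous f : (forall e : R, 0 < e ->
  exists2 g : X -> R, continuous g & forall x, `|f x - g x| <= e) -> continuous f.
Proof.
move=> h; apply: continuous_near => x e e0.
have e3 : 0 < e / 3 by rewrite divr_gt0.
have [g gc fg] := h _ e3.
have gn : \forall x' \near x, `|g x - g x'| < e / 3.
  have /cvgrPdist_lt := gc x; exact.
apply: filterS gn => x' gx.
have := fg x; have := fg x'; move: gx.
by rewrite ltr_norml !ler_norml => /andP[? ?] /andP[? ?] /andP[? ?]; apply/andP; split; lra.
Qed.

(** The range of the linearized operator is closed. The limit is reached as
    the supremum of the lower bounds [q_e - K * e], which stays within [K * e]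
    of every [q_e]. *)
Lemma near_solution_exact F1 F2 :
  (forall e : R, 0 < e -> exists q1 q2, near_solution F1 F2 q1 q2 e) ->
  exists q1 q2, near_solution F1 F2 q1 q2 0.
Proof.
move=> h.
have /choice[Q QP] : forall e : R, exists q : (X -> R) * (X -> R),
    0 < e -> near_solution F1 F2 q.1 q.2 e.
  move=> e; have [e0|] := ltP 0 e; last by exists (cst 0, cst 0).
  by have [q1 [q2 q12]] := h e e0; exists (q1, q2).
have close (e e' : R) : 0 < e -> 0 < e' -> forall x,
    `|(Q e).1 x - (Q e').1 x| <= K * (e + e') /\
    `|(Q e).2 x - (Q e').2 x| <= K * (e + e').
  move=> e0 e'0 x; have := near_solution_close (QP _ e0) (QP _ e'0) _ _ x.
  by move=> /(_ 0); rewrite addr0; apply => y; rewrite subrr normr0.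
have limit (u : R -> X -> R) : (forall e e' : R, 0 < e -> 0 < e' -> forall x,
    `|u e x - u e' x| <= K * (e + e')) ->
    exists v : X -> R, forall e : R, 0 < e -> forall x, `|v x - u e x| <= K * e.
  move=> uK; pose S x := [set z | exists2 e, 0 < e & z = u e x - K * e].
  have Sub x e : 0 < e -> ubound (S x) (u e x + K * e).
    move=> e0 _ [e' e'0 ->]; have := uK e e' e0 e'0 x.
    by rewrite ler_norml mulrDr => /andP[? ?]; lra.
  exists (fun x => sup (S x)) => e e0 x; rewrite ler_norml; apply/andP; split.
    rewrite -lerBlDr opprK addrC; apply: ub_le_sup; last by exists e.
    by exists (u e x + K * e); exact: Sub.
  rewrite lerBlDr addrC; apply: ge_sup; last exact: Sub.
  by exists (u 1 x - K * 1), 1.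
have [v1 v1P] := limit (fun e => (Q e).1) (fun e e' e0 e'0 x => (close e e' e0 e'0 x).1).
have [v2 v2P] := limit (fun e => (Q e).2) (fun e e' e0 e'0 x => (close e e' e0 e'0 x).2).
have K0 := solution_const_ge0.
have K1 : 0 < K + 1 by rewrite ltr_wpDl.
have small (e : R) : 0 < e -> K * (e / (K + 1)) <= e.
  move=> e0; rewrite mulrA ler_pdivrMr// mulrC ler_wpM2l ?(ltW e0)//.
  by rewrite lerDl.
have v1c : continuous v1.
  apply: uniform_limit_continuous => e e0.
  have e'0 : 0 < e / (K + 1) by rewrite divr_gt0.
  exists (Q (e / (K + 1))).1; first by case: (QP _ e'0).
  by move=> x; apply: le_trans (small _ e0); exact: v1P.
have v2c : continuous v2.
  apply: uniform_limit_continuous => e e0.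
  have e'0 : 0 < e / (K + 1) by rewrite divr_gt0.
  exists (Q (e / (K + 1))).2; first by case: (QP _ e'0).
  by move=> x; apply: le_trans (small _ e0); exact: v2P.
have p0 x y : 0 <= p x y by apply: le_trans (pd x y); exact: ltW.
have residual (p' : X -> X -> R) (mu : P) (u v q w F : X -> R) (e : R) (x : X) :
    continuous2 p' ->
    (forall x y, 0 <= p' x y) -> (forall x, \int[mu]_y p' x y = 1) ->
    continuous v -> continuous w ->
    (forall x, `|u x - q x| <= K * e) -> (forall x, `|v x - w x| <= K * e) ->
    `|linearized_op p' mu q w x - F x| <= e ->
    `|linearized_op p' mu u v x - F x| <= (K + K + 1) * e.
  move=> p'c p'0 p'1 vc wc uq vw SF.
  have -> : linearized_op p' mu u v x - F x =
     (linearized_op p' mu q w x - F x) +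
     linearized_op p' mu (fun x => u x - q x) (fun x => v x - w x) x.
    by rewrite linearized_opB//; ring.
  rewrite addrC (_ : (K + K + 1) * e = K * e + K * e + e); last by ring.
  apply: le_trans (ler_normD _ _) _; apply: lerD => //.
  apply: le_trans (ler_normD _ _) _; apply: lerD => //.
  by apply: markov_norm_le => //; exact: continuous_sub.
exists v1, v2; split => //.
- apply: (@eq_of_small_dist _ _ _ (K + K)) => e e0.
  have [_ _ qo _ _] := QP _ e0.
  have := v1P _ e0 x1o; have := v2P _ e0 x2o.
  rewrite qo (_ : (K + K) * e = K * e + K * e); last by ring.
  by rewrite !ler_norml => /andP[? ?] /andP[? ?]; apply/andP; split; lra.
- move=> x; rewrite (_ : linearized_op _ _ _ _ _ = F1 x) ?subrr ?normr0//.
  apply: (@eq_of_small_dist _ _ _ (K + K + 1)) => e e0.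
  have [q1c q2c _ S1 _] := QP _ e0.
  by apply: (residual p mu2 v1 v2 (Q e).1 (Q e).2) => //; [exact: v1P|exact: v2P].
- move=> x; rewrite (_ : linearized_op _ _ _ _ _ = F2 x) ?subrr ?normr0//.
  apply: (@eq_of_small_dist _ _ _ (K + K + 1)) => e e0.
  have [q1c q2c _ _ S2] := QP _ e0.
  by apply: (residual pT mu1 v2 v1 (Q e).2 (Q e).1) => //; [exact: v2P|exact: v1P].
Qed.

End NearSolution.

Section Convergence.
Context {R : realType} {d : nat} {a : 'rV[R]_d} {r : {posnum R}} (s : nat).
Local Notation X := (Xball a r).
Local Notation P := (probability (borelX a r) R).
Local Notation L := (ufun R (@Bs R d a r s)).

Lemma Cs_cvg_ball T (F : set_system T) (f : T -> ufun R X) (l : ufun R X) (e : R) :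
  Filter F -> Cs_cvg s F f l -> 0 < e ->
  \forall t \near F, Cs_ball s e (fun x => f t x - l x).
Proof.
move=> FF [Cf Cl fl] e0.
have := fl; move=> /cvgrPdist_lt /(_ _ e0); apply: filterS2 Cf => t Ct.
rewrite sub0r normrN => lte.
apply: Cs_ball_of_norm; first exact: CsB.
by apply: le_trans (ltW lte); exact: ler_norm.
Qed.

(** Convergence in C^s of the potentials is used here: [h_ t] is tested against
    functionals that converge on the unit ball of C^s only. *)
Lemma second_order_cvg (eps : R) (p : X -> X -> R) (B : R) (mu : P)
    T (F : set_system T) (gam_ : T -> L) (gam : L) G
    (h1_ h2_ : T -> ufun R X) (h1 h2 : ufun R X) : 0 < eps ->
  (forall x, Cs_ball s B (p x)) -> Filter F -> 0 <= G -> bounded_linear gam G ->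
  (forall e : R, 0 < e -> \forall t \near F, ball gam e (gam_ t)) ->
  Cs_cvg s F h1_ h1 -> Cs_cvg s F h2_ h2 ->
  forall e : R, 0 < e -> \forall t \near F, forall x,
    `|second_order eps p mu (gam_ t) (h1_ t) (h2_ t) x -
      second_order eps p mu gam h1 h2 x| <= e.
Proof.
move=> eps0 pB FF G0 Lg gg hh1 hh2 e e0.
have [_ Ch1 _] := hh1; have [_ Ch2 _] := hh2.
have N1 := Cs_ball_ge0 (Cs_ball_self Ch1); have N2 := Cs_ball_ge0 (Cs_ball_self Ch2).
pose H := Cs_norm s h1 + Cs_norm s h2 + 1.
have H0 : 0 <= H by rewrite !addr_ge0.
have [C C0 hC] := second_order_lipschitz eps0 pB G0 H0.
pose eta := Num.min 1 (e / (C + 1)).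
have C1 : 0 < C + 1 by rewrite ltr_wpDl.
have eta0 : 0 < eta by rewrite lt_min ltr01 divr_gt0.
have eta1 : eta <= 1 by rewrite ge_min lexx.
have etaC : C * eta <= e.
  apply: (@le_trans _ _ ((C + 1) * (e / (C + 1)))).
    by rewrite ler_pM ?(ltW eta0)// ?lerDl// ge_min lexx orbT.
  by rewrite mulrCA mulfV ?mulr1// gt_eqF.
have Cmono (u l : ufun R X) : Cs_ball s eta (fun x => u x - l x) -> Cs s l ->
    Cs_norm s l + 1 <= H -> Cs_ball s H u.
  move=> Cu Cl lH.
  have : Cs_ball s (eta + Cs_norm s l) (fun x => (u x - l x) + l x).
    by apply: Cs_ballD => //; exact: Cs_ball_self.
  under eq_fun do rewrite subrK.
  by apply: Cs_ball_le; lra.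
near=> t => x.
have D1 : Cs_ball s eta (fun x => h1_ t x - h1 x) by near: t; exact: Cs_cvg_ball.
have D2 : Cs_ball s eta (fun x => h2_ t x - h2 x) by near: t; exact: Cs_cvg_ball.
have gt : ball gam eta (gam_ t) by near: t; exact: gg.
rewrite distrC; apply: le_trans etaC; apply: hC => //.
- by apply: Cs_ball_le (Cs_ball_self Ch1); rewrite /H; lra.
- by apply: Cs_ball_le (Cs_ball_self Ch2); rewrite /H; lra.
- by apply: Cmono D1 Ch1 _; rewrite /H; lra.
- by apply: Cmono D2 Ch2 _; rewrite /H; lra.
- have := Cs_ballZ (-1) D1; rewrite normrN1 mul1r.
  by congr Cs_ball; apply/funext => y; ring.
- have := Cs_ballZ (-1) D2; rewrite normrN1 mul1r.
  by congr Cs_ball; apply/funext => y; ring.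
Unshelve. all: by end_near. Qed.

End Convergence.

(** * Limits along a path *)

Section OneSidedLimits.
Context {R : realType} {d : nat} {a : 'rV[R]_d} {r : {posnum R}} (s : nat).
Local Notation X := (Xball a r).
Local Notation P := (probability (borelX a r) R).
Local Notation L := (ufun R (@Bs R d a r s)).
Variables (eps : R) (eps0 : 0 < eps) (p : X -> X -> R) (B : R) (mu : P).
Hypothesis pB : forall x, Cs_ball s B (p x).
Hypothesis pc : continuous2 p.
Hypothesis p0 : forall x y, 0 <= p x y.
Hypothesis p1 : forall x, \int[mu]_y p x y = 1.
Variables (nu : R -> P) (h1_ h2_ : R -> ufun R X) (h1 h2 : ufun R X).
Hypothesis hh1 : Cs_cvg s 0^'+ h1_ h1.
Hypothesis hh2 : Cs_cvg s 0^'+ h2_ h2.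
Hypothesis schr : \forall t \near 0^'+, forall x,
  \int[nu t]_y (p x y * expR (t / eps * (h1_ t x + h2_ t y))) = 1.

Local Notation H := (Cs_norm s h1 + Cs_norm s h2 + 1).

Let H0 : 0 <= H.
Proof.
have [_ Ch1 _] := hh1; have [_ Ch2 _] := hh2.
rewrite !addr_ge0//; first exact: Cs_ball_ge0 (Cs_ball_self Ch1).
exact: Cs_ball_ge0 (Cs_ball_self Ch2).
Qed.

Let Cs_ball_h1 : \forall t \near 0^'+, Cs_ball s H (h1_ t).
Proof.
have [_ Ch1 _] := hh1; have [_ Ch2 _] := hh2.
near=> t.
have Cd : Cs_ball s 1 (fun x => h1_ t x - h1 x) by near: t; exact: Cs_cvg_ball.
have := Cs_ballD Cd (Cs_ball_self Ch1); under eq_fun do rewrite subrK.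
by apply: Cs_ball_le; have := Cs_ball_ge0 (Cs_ball_self Ch2); lra.
Unshelve. all: by end_near. Qed.

Let Cs_ball_h2 : \forall t \near 0^'+, Cs_ball s H (h2_ t).
Proof.
have [_ Ch1 _] := hh1; have [_ Ch2 _] := hh2.
near=> t.
have Cd : Cs_ball s 1 (fun x => h2_ t x - h2 x) by near: t; exact: Cs_cvg_ball.
have := Cs_ballD Cd (Cs_ball_self Ch2); under eq_fun do rewrite subrK.
by apply: Cs_ball_le; have := Cs_ball_ge0 (Cs_ball_self Ch1); lra.
Unshelve. all: by end_near. Qed.

Let near_small (C e : R) : 0 <= C -> 0 < e -> \forall t \near (0 : R)^'+, C * t <= e.
Proof.
move=> C0 e0; have C1 : 0 < C + 1 by rewrite ltr_wpDl.
near=> t.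
have t0 : 0 < t by [].
have : t <= e / (C + 1) by near: t; apply: nbhs_right_le; rewrite divr_gt0.
rewrite ler_pdivlMr// mulrC; apply: le_trans.
by rewrite ler_wpM2r ?(ltW t0)// lerDl.
Unshelve. all: by end_near. Qed.

(** For a direction attained exactly by the path, division of the equation by
    [t] gives the linearized equation for the limit of the quotients. *)
Lemma first_order_limit (gam : L) (G : R) : 0 <= G -> bounded_linear gam G ->
  (\forall t \near 0^'+, t^-1 *: (emb s (nu t) - emb s mu) = gam) ->
  forall x, eps^-1 * \int[mu]_y (p x y * (h1 x + h2 y)) + pairing gam (p x) = 0.
Proof.
move=> G0 Lg gamE x.
have [C C0 hC] := first_order eps0 pB H G0.
apply: (@eq_of_small_dist _ _ _ (1 + 2 / eps)) => e e0; rewrite subr0.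
near (0 : R)^'+ => t.
have t0 : 0 < t by [].
have D1 : Cs_ball s e (fun x => h1_ t x - h1 x) by near: t; exact: Cs_cvg_ball.
have D2 : Cs_ball s e (fun x => h2_ t x - h2 x) by near: t; exact: Cs_cvg_ball.
have Ch1 : Cs_ball s H (h1_ t) by near: t; exact: Cs_ball_h1.
have Ch2 : Cs_ball s H (h2_ t) by near: t; exact: Cs_ball_h2.
have Ht : (H + H) * t <= eps by near: t; apply: near_small => //; rewrite addr_ge0.
have Ct : C * t <= e by near: t; exact: near_small.
have t1 : t <= 1 by near: t; exact: nbhs_right_le.
have gE : t^-1 *: (emb s (nu t) - emb s mu) = gam by near: t.
have St x' : \int[nu t]_y (p x' y * expR (t / eps * (h1_ t x' + h2_ t y))) = 1.
  by move: x'; near: t.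
have := hC mu (nu t) t gam _ _ t0 t1 Ht (esym gE) Lg Ch1 Ch2 p1 St x.
have pcx := continuous2_section (x := x) pc.
have w1c : continuous (fun y => h1_ t x + h2_ t y).
  by apply: continuous_add; [exact: cst_continuous|exact: Cs_ball_continuous Ch2].
have [_ Ch2' _] := hh2.
have w2c : continuous (fun y => h1 x + h2 y).
  by apply: continuous_add; [exact: cst_continuous|exact: Cs_continuous Ch2'].
have : `|\int[mu]_y (p x y * ((h1_ t x + h2_ t y) - (h1 x + h2 y)))| <= e + e.
  apply: (markov_norm_le (p' := p)) => //; first exact: continuous_sub.
  move=> y; rewrite (_ : _ - _ = (h1_ t x - h1 x) + (h2_ t y - h2 y)); last by ring.
  apply: le_trans (ler_normD _ _) _.
  by apply: lerD; [exact: Cs_ball_bound D1 x|exact: Cs_ball_bound D2 y].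
have -> : \int[mu]_y (p x y * ((h1_ t x + h2_ t y) - (h1 x + h2 y))) =
   \int[mu]_y (p x y * (h1_ t x + h2_ t y)) - \int[mu]_y (p x y * (h1 x + h2 y)).
  rewrite -integralB_continuous; try exact: continuous_mul.
  by apply: eq_Rintegral => y _; rewrite mulrBr.
move: (\int[mu]_y (p x y * (h1_ t x + h2_ t y))) (\int[mu]_y (p x y * (h1 x + h2 y))).
move=> I1 I2 I12 zB.
have -> : eps^-1 * I2 + pairing gam (p x) =
  (eps^-1 * I1 + pairing gam (p x)) - eps^-1 * (I1 - I2) by ring.
apply: le_trans (ler_normB _ _) _; rewrite mulrDl mul1r; apply: lerD.
  exact: le_trans zB Ct.
rewrite normrM gtr0_norm ?invr_gt0//.
rewrite (_ : 2 / eps * e = eps^-1 * (e + e)); last by ring.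
by rewrite ler_wpM2l// invr_ge0 ltW.
Unshelve. all: by end_near. Qed.

Lemma second_order_limit (gam_ : R -> L) (gam : L) (G : R) (k1_ k2_ : R -> X -> R) :
  0 <= G -> bounded_linear gam G ->
  (\forall t \near 0^'+, gam_ t = t^-1 *: (emb s (nu t) - emb s mu)) ->
  (\forall t \near 0^'+, bounded_linear (gam_ t) G) ->
  (forall e : R, 0 < e -> \forall t \near 0^'+, ball gam e (gam_ t)) ->
  (\forall t \near 0^'+, continuous (k2_ t)) ->
  (\forall t \near 0^'+, forall x,
    eps^-1 * \int[mu]_y (p x y * (k1_ t x + k2_ t y)) + pairing (gam_ t) (p x) = 0) ->
  forall e : R, 0 < e -> \forall t \near 0^'+, forall x,
    `|linearized_op p mu (fun x => 2 / t * (h1_ t x - k1_ t x))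
        (fun x => 2 / t * (h2_ t x - k2_ t x)) x
      - second_order eps p mu gam h1 h2 x| <= e.
Proof.
move=> G0 Lg gamE Lgt gg kc kE e e0.
have [C C0 hC] := second_order_expansion eps0 pB H G0.
have e2 : 0 < e / 2 by rewrite divr_gt0.
near=> t => x.
have t0 : 0 < t by [].
have Ch1 : Cs_ball s H (h1_ t) by near: t; exact: Cs_ball_h1.
have Ch2 : Cs_ball s H (h2_ t) by near: t; exact: Cs_ball_h2.
have Ht : (H + H) * t <= eps by near: t; apply: near_small => //; rewrite addr_ge0.
have Ct : C * t <= e / 2 by near: t; exact: near_small.
have gE : gam_ t = t^-1 *: (emb s (nu t) - emb s mu) by near: t.
have Lt : bounded_linear (gam_ t) G by near: t.
have kct : continuous (k2_ t) by near: t.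
have kEt x' : eps^-1 * \int[mu]_y (p x' y * (k1_ t x' + k2_ t y)) +
    pairing (gam_ t) (p x') = 0 by move: x'; near: t.
have St x' : \int[nu t]_y (p x' y * expR (t / eps * (h1_ t x' + h2_ t y))) = 1.
  by move: x'; near: t.
have E1 := hC mu (nu t) t (gam_ t) _ _ (k1_ t) (k2_ t) t0 Ht gE Lt Ch1 Ch2 p1 St kct kEt x.
have E2 : `|second_order eps p mu (gam_ t) (h1_ t) (h2_ t) x -
    second_order eps p mu gam h1 h2 x| <= e / 2.
  by move: (x); near: t; exact: (second_order_cvg mu eps0 pB _ G0 Lg gg hh1 hh2 e2).
rewrite -(subrKA (second_order eps p mu (gam_ t) (h1_ t) (h2_ t) x)).
apply: le_trans (ler_normD _ _) _; rewrite [leRHS]splitr; apply: lerD => //.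
exact: le_trans E1 Ct.
Unshelve. all: by end_near. Qed.

End OneSidedLimits.

(** * Tangent directions and paths *)

Section Paths.
Context {R : realType} {d : nat} {a : 'rV[R]_d} {r : {posnum R}} (s : nat).
Local Notation X := (Xball a r).
Local Notation P := (probability (borelX a r) R).
Local Notation L := (ufun R (@Bs R d a r s)).
Implicit Types (mu nu : P * P) (g : L * L).

Definition diff_quotient mu nu (t : R) : L * L :=
  t^-1 *: (emb2 s nu - emb2 s mu).

Lemma admissible_M mu (mut : R -> P * P) t : admissible mu mut -> 0 < t ->
  M_ s mu.1 (diff_quotient mu (mut t) t).1 /\
  M_ s mu.2 (diff_quotient mu (mut t) t).2.
Proof.
move=> adm t0; have [P1 P2] := adm t t0.
by split; [exists (mut t).1, t^-1|exists (mut t).2, t^-1]; rewrite invr_gt0.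
Qed.

Lemma M_tangent mu g : M_ s mu.1 g.1 -> M_ s mu.2 g.2 -> tangent s mu g.
Proof. by move=> M1 M2; split; exact: subset_closure. Qed.

(** A point outside the support of [eta] has a neighborhood that is null for
    [eta] and one that is null for [nu]; their intersection is null for the
    mixture. *)
Lemma mixture_P (eta nu : P) (l : R) (l0 : 0 <= l) (l1 : l <= 1) :
  P_ eta nu -> P_ eta (mixture eta nu l0 l1 : P).
Proof.
move=> nueta x xmix; apply: contrapT => xeta.
have /existsNP[U /not_implyP[oU /not_implyP[Ux /negP U0]]] := xeta.
have xnu : ~ spt nu x by move=> /nueta.
have /existsNP[V /not_implyP[oV /not_implyP[Vx /negP V0]]] := xnu.
have oUV : open (U `&` V) by exact: openI.
have := xmix (U `&` V) oUV (conj Ux Vx).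
have mU : measurable (U : set (borelX a r)) by exact: sub_sigma_algebra.
have mV : measurable (V : set (borelX a r)) by exact: sub_sigma_algebra.
have mUV : measurable (U `&` V : set (borelX a r)) by exact: sub_sigma_algebra.
have etaUV : eta (U `&` V) = 0%E.
  apply/eqP; rewrite eq_le measure_ge0 andbT; apply: le_trans (_ : eta U <= 0)%E.
    by apply: le_measure; rewrite ?inE//; exact: subIsetl.
  by rewrite leNgt.
have nuUV : nu (U `&` V) = 0%E.
  apply/eqP; rewrite eq_le measure_ge0 andbT; apply: le_trans (_ : nu V <= 0)%E.
    by apply: le_measure; rewrite ?inE//; exact: subIsetr.
  by rewrite leNgt.
have -> : (mixture eta nu l0 l1 : P) (U `&` V) = mixture eta nu l0 l1 (U `&` V) by [].
by rewrite mixtureE etaUV nuUV !mule0 adde0 ltxx.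
Qed.

(** The path [eta + t k (nu - eta)], stopped at [nu] to remain a probability. *)
Lemma linear_path_M (eta : P) (gam : L) : M_ s eta gam -> exists m : R -> P,
  (forall t, 0 < t -> P_ eta (m t)) /\
  \forall t \near 0^'+, t^-1 *: (emb s (m t) - emb s eta) = gam.
Proof.
move=> [nu [k [nueta k0 ->]]].
pose l t := Num.min 1 (Num.max 0 (t * k)).
have l0 t : 0 <= l t by rewrite le_min ler01 le_max lexx.
have l1 t : l t <= 1 by rewrite ge_min lexx.
exists (fun t => mixture eta nu (l0 t) (l1 t)); split.
  by move=> t _; exact: mixture_P.
near=> t.
have t0 : 0 < t by [].
have tk : t * k <= 1.
  by rewrite -ler_pdivlMr// div1r; near: t; apply: nbhs_right_le; rewrite invr_gt0.
have ltE : l t = t * k.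
  by rewrite /l max_r ?min_r// mulr_ge0 ?ltW.
apply/funext => f.
have -> : (t^-1 *: (emb s (mixture eta nu (l0 t) (l1 t)) - emb s eta)) f =
  t^-1 * (emb s (mixture eta nu (l0 t) (l1 t)) f - emb s eta f) by [].
have -> : (k *: (emb s nu - emb s eta)) f = k * (emb s nu f - emb s eta f) by [].
have fc : continuous (\val f : X -> R).
  by have := set_mem (valP f) => -[/Cs_continuous].
rewrite /emb integral_mixture// ltE.
by field; rewrite gt_eqF.
Unshelve. all: by end_near. Qed.

Lemma linear_path mu g : M_ s mu.1 g.1 -> M_ s mu.2 g.2 -> exists mut : R -> P * P,
  admissible mu mut /\ \forall t \near 0^'+, diff_quotient mu (mut t) t = g.
Proof.
move=> /linear_path_M[m1 [P1 E1]] /linear_path_M[m2 [P2 E2]].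
exists (fun t => (m1 t, m2 t)); split.
  by move=> t t0; split; [exact: P1|exact: P2].
apply: filterS2 E1 E2 => t E1 E2; rewrite /diff_quotient.
by rewrite [RHS]surjective_pairing -E1 -E2.
Qed.

Lemma cvg_pair_ball T (F : set_system T) (A B : choiceType)
    (f : T -> ufun R A * ufun R B) (l : ufun R A * ufun R B) : Filter F -> f @ F --> l ->
  forall e : R, 0 < e -> \forall t \near F, ball l.1 e (f t).1 /\ ball l.2 e (f t).2.
Proof.
by move=> FF /cvg_ballP fl e /fl; apply: filterS => t [].
Qed.

Lemma cvg_pair_uniform T (F : set_system T) (A B : choiceType)
    (f : T -> ufun R A * ufun R B) (l : ufun R A * ufun R B) : Filter F ->
  (forall e : R, 0 < e -> \forall t \near F,
    (forall x, `|l.1 x - (f t).1 x| <= e) /\ (forall x, `|l.2 x - (f t).2 x| <= e)) ->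
  f @ F --> l.
Proof.
move=> FF h; apply/cvg_ballP => e e0.
have e2 : 0 < e / 2 by rewrite divr_gt0.
have e2e : e / 2 < e by rewrite ltr_pdivrMr// ltr_pMr// ltr1n.
by apply: filterS (h _ e2) => t [h1 h2]; split => x; apply: le_lt_trans e2e.
Qed.

Lemma path_limit_tangent mu mut g : admissible mu mut ->
  diff_quotient mu (mut t) t @[t --> 0^'+] --> g -> tangent s mu g.
Proof.
move=> adm gl; split => U /nbhs_ballP[e /= e0 eU].
- near (0 : R)^'+ => t.
  have t0 : 0 < t by [].
  have [b1 b2] : ball g.1 e (diff_quotient mu (mut t) t).1 /\
      ball g.2 e (diff_quotient mu (mut t) t).2 by near: t; exact: cvg_pair_ball gl _ e0.
  exists (diff_quotient mu (mut t) t).1; split; last exact: eU.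
  by have [] := admissible_M adm t0.
- near (0 : R)^'+ => t.
  have t0 : 0 < t by [].
  have [b1 b2] : ball g.1 e (diff_quotient mu (mut t) t).1 /\
      ball g.2 e (diff_quotient mu (mut t) t).2 by near: t; exact: cvg_pair_ball gl _ e0.
  exists (diff_quotient mu (mut t) t).2; split; last exact: eU.
  by have [] := admissible_M adm t0.
Unshelve. all: by end_near. Qed.

Lemma bounded_linear_le (gam : L) (G G' : R) : G <= G' ->
  bounded_linear gam G -> bounded_linear gam G'.
Proof.
move=> GG' [hB hZ hb]; split => // f B Cf; apply: le_trans (hb f B Cf) _.
by rewrite ler_wpM2r// (Cs_ball_ge0 Cf).
Qed.

Lemma tangent_bounded_linear mu g : tangent s mu g -> exists2 G, 0 <= G &
  forall g', tangent s mu g' -> ball g.1 1 g'.1 -> ball g.2 1 g'.2 ->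
    bounded_linear g'.1 G /\ bounded_linear g'.2 G.
Proof.
move=> [/closure_bounded_linear[G1 G10 h1] /closure_bounded_linear[G2 G20 h2]].
exists (G1 + G2); first exact: addr_ge0.
move=> g' [t1 t2] b1 b2; split.
- by apply: bounded_linear_le (h1 _ t1 b1); rewrite lerDl.
- by apply: bounded_linear_le (h2 _ t2 b2); rewrite lerDr.
Qed.

Lemma tangentZ mu g (t : R) : 0 < t -> tangent s mu g -> tangent s mu (t *: g).
Proof.
move=> t0.
have clZ (eta : P) (gam : L) : closure (M_ s eta) gam -> closure (M_ s eta) (t *: gam).
  move=> cl U /nbhs_ballP[e /= e0 eU].
  have e't : 0 < e / t by rewrite divr_gt0.
  have [_ [nu [k [nueta k0 ->]]] bm] := closure_M_ball cl e't.
  exists (t *: (k *: (emb s nu - emb s eta))); split.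
    by exists nu, (t * k); rewrite mulr_gt0// scalerA.
  apply: eU => f.
  have -> : (t *: gam) f = t * gam f by [].
  have -> : (t *: (k *: (emb s nu - emb s eta))) f =
    t * (k *: (emb s nu - emb s eta)) f by [].
  have := bm f; rewrite /ball /= -mulrBr normrM gtr0_norm//.
  by rewrite ltr_pdivlMr// mulrC.
by move=> [t1 t2]; split; exact: clZ.
Qed.

End Paths.

(** * The second derivative *)

Section SecondDerivative.
Context {R : realType} {d : nat} (eps : R) (heps : 0 < eps).
Context (c : 'rV[R]_d -> 'rV[R]_d -> R) (c_sym : forall x y, c x y = c y x).
Context (c_smooth : smooth (fun z : 'rV[R]_(d + d) => c (lsubmx z) (rsubmx z))).
Context {a : 'rV[R]_d} {r : {posnum R}} (x1o x2o : Xball a r).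
Local Notation X := (Xball a r).
Local Notation P := (probability (borelX a r) R).
Context (phi : P * P -> ufun R X * ufun R X).
Context (phiP : forall mu, is_potentials eps c x1o x2o mu (phi mu)).
Context (s : nat) (mu : P * P).
Local Notation L := (ufun R (@Bs R d a r s)).
Context (D1 : L * L -> ufun R X * ufun R X).
Context (D1P : is_hadamard_derivative s phi mu D1).

Definition density (x1 x2 : X) : R := gibbs eps c (phi mu).1 (phi mu).2 x1 x2.
Local Notation p := density.
Local Notation pT := (fun y x => density x y).

Lemma density_int2 x1 : \int[mu.2]_x2 p x1 x2 = 1.
Proof. by case: (phiP mu) => _ _ e2 _ _; exact: e2. Qed.

Lemma density_int1 x2 : \int[mu.1]_x1 p x1 x2 = 1.
Proof. by case: (phiP mu) => _ _ _ e1 _; exact: e1. Qed.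

Lemma density_sym : pT = gibbs eps c (phi mu).2 (phi mu).1.
Proof.
apply/funext => y; apply/funext => x; rewrite /density /gibbs c_sym.
by rewrite [(phi mu).1 x + _]addrC.
Qed.

Lemma density_Cs_family n : Cs_family n p /\ Cs_family n pT.
Proof.
have [c1 c2 _ _ _] := phiP mu; split.
  exact: (gibbs_Cs_family c_smooth n c1 density_int1).
rewrite density_sym; apply: (gibbs_Cs_family (mu := mu.2) c_smooth n c2) => x.
by rewrite -(density_int2 x); apply: eq_Rintegral => y _; rewrite -density_sym.
Qed.

Lemma density_gt0 x y : 0 < p x y. Proof. exact: expR_gt0. Qed.

Lemma density_ge0 x y : 0 <= p x y. Proof. exact: expR_ge0. Qed.

Lemma density_continuous2 : continuous2 p.
Proof. exact: Cs_family_continuous (density_Cs_family 0).1. Qed.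

Lemma densityT_continuous2 : continuous2 pT.
Proof. exact: Cs_family_continuous (density_Cs_family 0).2. Qed.

Lemma density_bound :
  exists B, (forall x, Cs_ball s B (p x)) /\ (forall y, Cs_ball s B (pT y)).
Proof.
have [/Cs_family_bound[B1 B10 h1] /Cs_family_bound[B2 B20 h2]] := density_Cs_family s.
exists (B1 + B2); split => x.
- by apply: Cs_ball_le (h1 x); rewrite lerDl ltW.
- by apply: Cs_ball_le (h2 x); rewrite lerDr ltW.
Qed.

Lemma density_lower_bound : exists2 delta, 0 < delta & forall x y, delta <= p x y.
Proof. exact: Cs_family_lower_bound (density_Cs_family 0).1 density_gt0. Qed.

Definition potential_quotient (nu : P * P) (t : R) : ufun R X * ufun R X :=
  t^-1 *: (phi nu - phi mu).

Lemma quotient_equations nu t : 0 < t ->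
  let h := potential_quotient nu t in
  (forall x, \int[nu.2]_y (p x y * expR (t / eps * (h.1 x + h.2 y))) = 1) /\
  (forall y, \int[nu.1]_x (pT y x * expR (t / eps * (h.2 y + h.1 x))) = 1).
Proof.
move=> t0 h; have [_ _ e2 e1 _] := phiP nu.
have h1E x : h.1 x = t^-1 * ((phi nu).1 x - (phi mu).1 x) by [].
have h2E x : h.2 x = t^-1 * ((phi nu).2 x - (phi mu).2 x) by [].
split=> x.
  rewrite -[RHS](e2 x); apply: eq_Rintegral => y _; rewrite /density /gibbs -expRD.
  by congr expR; rewrite h1E h2E; field; rewrite !gt_eqF.
rewrite -[RHS](e1 x); apply: eq_Rintegral => y _; rewrite /density /gibbs -expRD.
by congr expR; rewrite h1E h2E; field; rewrite !gt_eqF.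
Qed.

Lemma quotient_normalized nu t :
  (potential_quotient nu t).1 x1o = (potential_quotient nu t).2 x2o.
Proof.
have [_ _ _ _ nu_o] := phiP nu; have [_ _ _ _ mu_o] := phiP mu.
have -> : (potential_quotient nu t).1 x1o = t^-1 * ((phi nu).1 x1o - (phi mu).1 x1o) by [].
by rewrite nu_o mu_o.
Qed.

Lemma D1_path mut g : admissible mu mut ->
  diff_quotient s mu (mut t) t @[t --> 0^'+] --> g ->
  Cs_cvg s 0^'+ (fun t => (potential_quotient (mut t) t).1) (D1 g).1 /\
  Cs_cvg s 0^'+ (fun t => (potential_quotient (mut t) t).2) (D1 g).2.
Proof. by case: D1P => _ _; apply. Qed.

Definition solves_linearized (g : L * L) (k : ufun R X * ufun R X) : Prop :=
  [/\ continuous (k.1 : X -> R), continuous (k.2 : X -> R), k.1 x1o = k.2 x2o,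
   (forall x, eps^-1 * \int[mu.2]_y (p x y * (k.1 x + k.2 y)) +
     pairing g.2 (p x) = 0) &
   (forall y, eps^-1 * \int[mu.1]_x (pT y x * (k.2 y + k.1 x)) +
     pairing g.1 (pT y) = 0)].

(** On differences of measures the first derivative solves the linearized
    system, as seen along the linear path with direction [g]. *)
Lemma D1_linearized g : M_ s mu.1 g.1 -> M_ s mu.2 g.2 ->
  solves_linearized g (D1 g).
Proof.
move=> M1 M2; have [mut [adm gE]] := linear_path M1 M2.
have gl : diff_quotient s mu (mut t) t @[t --> 0^'+] --> g.
  by apply: cvg_trans (near_eq_cvg _) (cvg_cst g); apply: filterS gE => t ->.
have [cv1 cv2] := D1_path adm gl.
have [_ C1 _] := cv1; have [_ C2 _] := cv2.
have [B [pB pTB]] := density_bound.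
have [G G0 hG] := tangent_bounded_linear (M_tangent M1 M2).
have [L1 L2] : bounded_linear g.1 G /\ bounded_linear g.2 G.
  by apply: hG; [exact: M_tangent|exact: ballxx|exact: ballxx].
split.
- exact: Cs_continuous C1.
- exact: Cs_continuous C2.
- apply: (@eq_of_small_dist _ _ _ 2) => e e0.
  near (0 : R)^'+ => t.
  have c1 : Cs_ball s e (fun x => (potential_quotient (mut t) t).1 x - (D1 g).1 x).
    by near: t; exact: Cs_cvg_ball.
  have c2 : Cs_ball s e (fun x => (potential_quotient (mut t) t).2 x - (D1 g).2 x).
    by near: t; exact: Cs_cvg_ball.
  have := Cs_ball_bound c1 x1o; have := Cs_ball_bound c2 x2o; rewrite quotient_normalized.
  by rewrite !ler_norml => /andP[? ?] /andP[? ?]; apply/andP; split; lra.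
- apply: (first_order_limit (nu := fun t => (mut t).2) heps pB
    density_continuous2 density_ge0 density_int2 cv1 cv2 _ G0 L2).
    by near=> t; have [] := quotient_equations (mut t) (t := t) _.
  by apply: filterS gE => t <-.
- apply: (first_order_limit (nu := fun t => (mut t).1) heps pTB
    densityT_continuous2 (fun y x => density_ge0 x y) density_int1 cv2 cv1 _ G0 L1).
    by near=> t; have [] := quotient_equations (mut t) (t := t) _.
  by apply: filterS gE => t <-.
Unshelve. all: by end_near. Qed.

Definition rhs1 (g : L * L) : X -> R :=
  second_order eps p mu.2 g.2 (D1 g).1 (D1 g).2.

Definition rhs2 (g : L * L) : X -> R :=
  second_order eps pT mu.1 g.1 (D1 g).2 (D1 g).1.

Definition approx_second (g : L * L) (q : ufun R X * ufun R X) (e : R) : Prop :=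
  near_solution p mu.1 mu.2 x1o x2o (rhs1 g) (rhs2 g) q.1 q.2 e.

Definition second_quotient (mut : R -> P * P) (t : R) : ufun R X * ufun R X :=
  (t ^+ 2 / 2)^-1 *: (phi (mut t) - phi mu - t *: D1 (diff_quotient s mu (mut t) t)).

(** The first derivative at the difference quotients solves the linearized
    system exactly, so that only second-order terms remain. *)
Lemma path_approx_second mut g : admissible mu mut ->
  diff_quotient s mu (mut t) t @[t --> 0^'+] --> g ->
  forall e : R, 0 < e -> \forall t \near 0^'+, approx_second g (second_quotient mut t) e.
Proof.
move=> adm gl e e0.
have tg := path_limit_tangent adm gl.
have [cv1 cv2] := D1_path adm gl.
have [B [pB pTB]] := density_bound.
have [G G0 hG] := tangent_bounded_linear tg.
have [L1 L2] : bounded_linear g.1 G /\ bounded_linear g.2 G.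
  by apply: hG; [exact: tg|exact: ballxx|exact: ballxx].
pose gam t := diff_quotient s mu (mut t) t.
have balls := cvg_pair_ball _ gl.
have Lgam : \forall t \near 0^'+, bounded_linear (gam t).1 G /\ bounded_linear (gam t).2 G.
  near=> t.
  have t0 : 0 < t by [].
  have [b1 b2] : ball g.1 1 (gam t).1 /\ ball g.2 1 (gam t).2 by near: t; exact: balls.
  by have [M1 M2] := admissible_M s adm t0; apply: hG => //; exact: M_tangent.
have lin : \forall t \near 0^'+, solves_linearized (gam t) (D1 (gam t)).
  near=> t; have t0 : 0 < t by [].
  by have [M1 M2] := admissible_M s adm t0; exact: D1_linearized.
have E1 := second_order_limit (nu := fun t => (mut t).2) (gam_ := fun t => (gam t).2)
  (k1_ := fun t => (D1 (gam t)).1) (k2_ := fun t => (D1 (gam t)).2)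
  heps pB density_int2 cv1 cv2 _ G0 L2 _ _ _ _ _ e0.
have E2 := second_order_limit (nu := fun t => (mut t).1) (gam_ := fun t => (gam t).1)
  (k1_ := fun t => (D1 (gam t)).2) (k2_ := fun t => (D1 (gam t)).1)
  heps pTB density_int1 cv2 cv1 _ G0 L1 _ _ _ _ _ e0.
near=> t; have t0 : 0 < t by [].
have q1E : (second_quotient mut t).1 =
    (fun x => 2 / t * ((potential_quotient (mut t) t).1 x - (D1 (gam t)).1 x)).
  apply/funext => x.
  have -> : (second_quotient mut t).1 x =
    (t ^+ 2 / 2)^-1 * ((phi (mut t)).1 x - (phi mu).1 x - t * (D1 (gam t)).1 x) by [].
  have -> : (potential_quotient (mut t) t).1 x = t^-1 * ((phi (mut t)).1 x - (phi mu).1 x).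
    by [].
  by field; rewrite gt_eqF.
have q2E : (second_quotient mut t).2 =
    (fun x => 2 / t * ((potential_quotient (mut t) t).2 x - (D1 (gam t)).2 x)).
  apply/funext => x.
  have -> : (second_quotient mut t).2 x =
    (t ^+ 2 / 2)^-1 * ((phi (mut t)).2 x - (phi mu).2 x - t * (D1 (gam t)).2 x) by [].
  have -> : (potential_quotient (mut t) t).2 x = t^-1 * ((phi (mut t)).2 x - (phi mu).2 x).
    by [].
  by field; rewrite gt_eqF.
have [k1c k2c ko _ _] : solves_linearized (gam t) (D1 (gam t)) by near: t.
have h1c : Cs s (potential_quotient (mut t) t).1 by near: t; case: cv1.
have h2c : Cs s (potential_quotient (mut t) t).2 by near: t; case: cv2.
rewrite /approx_second q1E q2E; split.
- by apply: continuous_scale; apply: continuous_sub => //; exact: Cs_continuous h1c.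
- by apply: continuous_scale; apply: continuous_sub => //; exact: Cs_continuous h2c.
- by rewrite quotient_normalized ko.
- near: t; apply: E1.
  + by near=> t; have [] := quotient_equations (mut t) (t := t) _.
  + by near=> t.
  + by apply: filterS Lgam => t [].
  + by move=> e' /balls; apply: filterS => t [].
  + by apply: filterS lin => t [].
  + by apply: filterS lin => t [].
- near: t; apply: E2.
  + by near=> t; have [] := quotient_equations (mut t) (t := t) _.
  + by near=> t.
  + by apply: filterS Lgam => t [].
  + by move=> e' /balls; apply: filterS => t [].
  + by apply: filterS lin => t [].
  + by apply: filterS lin => t [].
Unshelve. all: by end_near. Qed.

Lemma rhs_continuous g : tangent s mu g -> forall e : R, 0 < e ->
  \forall g' \near within (tangent s mu) (nbhs g),
    (forall x, `|rhs1 g' x - rhs1 g x| <= e) /\ (forall x, `|rhs2 g' x - rhs2 g x| <= e).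
Proof.
move=> tg e e0; have [cv _ _] := D1P; have [cv1 cv2] := cv g tg.
have [B [pB pTB]] := density_bound.
have [G G0 hG] := tangent_bounded_linear tg.
have [L1 L2] : bounded_linear g.1 G /\ bounded_linear g.2 G.
  by apply: hG; [exact: tg|exact: ballxx|exact: ballxx].
have wl : (fun g' : L * L => g') @ within (tangent s mu) (nbhs g) --> g.
  exact: cvg_within.
have balls := cvg_pair_ball _ wl.
have E1 := second_order_cvg (gam_ := fun g' : L * L => g'.2) mu.2
  heps pB _ G0 L2 _ cv1 cv2 e0.
have E2 := second_order_cvg (gam_ := fun g' : L * L => g'.1) mu.1
  heps pTB _ G0 L1 _ cv2 cv1 e0.
near=> g'; split.
- near: g'; apply: E1 => e' /balls; by apply: filterS => t [].
- near: g'; apply: E2 => e' /balls; by apply: filterS => t [].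
Unshelve. all: by end_near. Qed.

Lemma approx_close delta g g' q q' e e' eta :
  0 < delta -> (forall x y, delta <= p x y) ->
  approx_second g q e -> approx_second g' q' e' ->
  (forall x, `|rhs1 g x - rhs1 g' x| <= eta) ->
  (forall x, `|rhs2 g x - rhs2 g' x| <= eta) ->
  (forall x, `|q.1 x - q'.1 x| <= solution_const delta * (e + e' + eta)) /\
  (forall x, `|q.2 x - q'.2 x| <= solution_const delta * (e + e' + eta)).
Proof.
move=> d0 pd S S' F1 F2.
have h := near_solution_close density_continuous2 densityT_continuous2 d0 pd
  density_int2 density_int1 S S' F1 F2.
by split => x; have [] := h x.
Qed.

Lemma approx_exact g : (forall e : R, 0 < e -> exists q, approx_second g q e) ->
  exists q, approx_second g q 0.
Proof.
move=> h; have [delta d0 pd] := density_lower_bound.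
have [|q1 [q2 q12]] := near_solution_exact (F1 := rhs1 g) (F2 := rhs2 g)
    (x1o := x1o) (x2o := x2o) density_continuous2 densityT_continuous2 d0 pd
    density_int2 density_int1.
  by move=> e /h[q qe]; exists q.1, q.2.
by exists (q1, q2).
Qed.

(** For a difference of measures, the quotients along the linear path are
    approximate solutions; a limit direction is reached because the right-hand
    side of the system is continuous and its range is closed. *)
Lemma exact_solution g : tangent s mu g -> exists q, approx_second g q 0.
Proof.
have exactM g' : M_ s mu.1 g'.1 -> M_ s mu.2 g'.2 -> exists q, approx_second g' q 0.
  move=> M1 M2; have [mut [adm gE]] := linear_path M1 M2.
  have gl : diff_quotient s mu (mut t) t @[t --> 0^'+] --> g'.
    by apply: cvg_trans (near_eq_cvg _) (cvg_cst g'); apply: filterS gE => t ->.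
  apply: approx_exact => e e0.
  near (0 : R)^'+ => t.
  by exists (second_quotient mut t); near: t; exact: path_approx_second.
move=> tg; apply: approx_exact => e e0.
have /nbhs_ballP[eta /= eta0 he] := rhs_continuous tg e0.
have [t1 t2] := tg.
have [m1 Mm1 b1] := closure_M_ball t1 eta0; have [m2 Mm2 b2] := closure_M_ball t2 eta0.
have [r1 r2] := he (m1, m2) (conj b1 b2) (M_tangent (g := (m1, m2)) Mm1 Mm2).
have [q [q1c q2c qo S1 S2]] := exactM (m1, m2) Mm1 Mm2.
exists q; split => // x.
- have := r1 x; have := S1 x; rewrite normr_le0 subr_eq0 => /eqP ->; exact.
- have := r2 x; have := S2 x; rewrite normr_le0 subr_eq0 => /eqP ->; exact.
Unshelve. all: by end_near. Qed.

(** On tangent directions there is exactly one such [q], by [exact_solution] and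
    [approx_close]; [0] is the default value. *)
Definition D2 (g : L * L) : ufun R X * ufun R X :=
  xget 0 [set q | approx_second g q 0].

Lemma D2_solves g : tangent s mu g -> approx_second g (D2 g) 0.
Proof. by move=> /exact_solution; exact: (@xgetPex _ 0 [set q | approx_second g q 0]). Qed.

Lemma D2_continuous : {within tangent s mu, continuous D2}.
Proof.
apply/subspace_continuousP => g tg.
have [delta d0 pd] := density_lower_bound.
have K0 := solution_const_ge0 d0.
have K1 : 0 < solution_const delta + 1 by rewrite ltr_wpDl.
apply: cvg_pair_uniform => e e0.
have e'0 : 0 < e / (solution_const delta + 1) by rewrite divr_gt0.
have small : solution_const delta * (e / (solution_const delta + 1)) <= e.
  rewrite mulrA ler_pdivrMr// mulrC ler_wpM2l ?(ltW e0)//; lra.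
near=> g'.
have tg' : tangent s mu g' by near: g'; exact: withinT.
have [r1 r2] : (forall x, `|rhs1 g' x - rhs1 g x| <= e / (solution_const delta + 1)) /\
    (forall x, `|rhs2 g' x - rhs2 g x| <= e / (solution_const delta + 1)).
  by near: g'; exact: rhs_continuous.
have [|| h1 h2] := approx_close d0 pd (D2_solves tg) (D2_solves tg')
  (eta := e / (solution_const delta + 1)).
- by move=> x; rewrite distrC.
- by move=> x; rewrite distrC.
by rewrite !add0r in h1 h2; split => x; apply: le_trans small.
Unshelve. all: by end_near. Qed.

Lemma D2_limit mut g : admissible mu mut ->
  diff_quotient s mu (mut t) t @[t --> 0^'+] --> g ->
  second_quotient mut t @[t --> 0^'+] --> D2 g.
Proof.
move=> adm gl; have tg := path_limit_tangent adm gl.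
have [delta d0 pd] := density_lower_bound.
have K0 := solution_const_ge0 d0.
have K1 : 0 < solution_const delta + 1 by rewrite ltr_wpDl.
apply: cvg_pair_uniform => e e0.
have e'0 : 0 < e / (solution_const delta + 1) by rewrite divr_gt0.
have small : solution_const delta * (e / (solution_const delta + 1)) <= e.
  rewrite mulrA ler_pdivrMr// mulrC ler_wpM2l ?(ltW e0)//; lra.
apply: filterS (path_approx_second adm gl e'0) => t St.
have [|| h1 h2] := approx_close d0 pd (D2_solves tg) St (eta := 0).
- by move=> x; rewrite subrr normr0.
- by move=> x; rewrite subrr normr0.
by rewrite !add0r addr0 in h1 h2; split => x; apply: le_trans small.
Qed.

Lemma D1Z g (t : R) : tangent s mu g -> tangent s mu (t *: g) -> D1 (t *: g) = t *: D1 g.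
Proof.
move=> tg ttg; have [_ [Lin [Llin LE]] _] := D1P.
have hull u : tangent s mu u -> lin_hull (tangent s mu) u.
  move=> tu; exists 1%N, (fun=> 1), (fun=> u); split => //.
  by rewrite big_ord1 scale1r.
have hull0 : lin_hull (tangent s mu) 0.
  by exists 0%N, (fun=> 0), (fun=> 0); split; [case|rewrite big_ord0].
have L0 : Lin 0 = 0.
  have := Llin 1 0 0 hull0 hull0; rewrite scale1r addr0 scale1r.
  by move=> /eqP; rewrite -subr_eq0 opprD addrA subrr sub0r oppr_eq0 => /eqP.
by rewrite -!LE// -[t *: g]addr0 (Llin _ _ _ (hull _ tg) hull0) L0 addr0.
Qed.

Lemma second_orderZ (p' : X -> X -> R) B (nu : P) (gam : L) G (h1 h2 : ufun R X) (t : R) x :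
  bounded_linear gam G -> (forall x, Cs_ball s B (p' x)) -> Cs s h1 -> Cs s h2 ->
  second_order eps p' nu (t *: gam) (t *: h1) (t *: h2) x =
  t ^+ 2 * second_order eps p' nu gam h1 h2 x.
Proof.
move=> Lg pB Ch1 Ch2; rewrite /second_order.
have Cw : Cs_ball s (`|h1 x| + Cs_norm s h2) (fun y => h1 x + h2 y).
  by apply: Cs_ballD; [exact: Cs_ball_cst|exact: Cs_ball_self].
have Cpw := Cs_ballM (pB x) Cw; have Cpw2 := Cs_ballM (pB x) (Cs_ballM Cw Cw).
have t1E y : (t *: h1) y = t * h1 y by [].
have t2E y : (t *: h2) y = t * h2 y by [].
have pairZ f : pairing (t *: gam) f = t * pairing gam f.
  rewrite /pairing mulrCA; congr (_ * _); rewrite /= !oinv_set_val.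
  by case: insub => //=; rewrite mulr0.
rewrite pairZ.
have -> : (fun y => p' x y * ((t *: h1) x + (t *: h2) y)) =
    (fun y => t * (p' x y * (h1 x + h2 y))).
  by apply/funext => y; rewrite t1E t2E; ring.
rewrite (pairingZ Lg t (Cs_ball_Cs Cpw)).
have -> : \int[nu]_y (p' x y * (((t *: h1) x + (t *: h2) y) * ((t *: h1) x + (t *: h2) y))) =
    t ^+ 2 * \int[nu]_y (p' x y * ((h1 x + h2 y) * (h1 x + h2 y))).
  rewrite -(integralZ_continuous nu (t ^+ 2) (Cs_ball_continuous Cpw2)).
  by apply: eq_Rintegral => y _; rewrite t1E t2E; ring.
by ring.
Qed.

Lemma D2Z g (t : R) : 0 < t -> tangent s mu g -> D2 (t *: g) = t ^+ 2 *: D2 g.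
Proof.
move=> t0 tg; have ttg := tangentZ t0 tg.
have [delta d0 pd] := density_lower_bound.
have [B [pB pTB]] := density_bound.
have [cv _ _] := D1P; have [[_ C1 _] [_ C2 _]] := cv g tg.
have [G G0 hG] := tangent_bounded_linear tg.
have [L1 L2] : bounded_linear g.1 G /\ bounded_linear g.2 G.
  by apply: hG; [exact: tg|exact: ballxx|exact: ballxx].
have D1E := D1Z tg ttg.
have scaleS (p' : X -> X -> R) (nu : P) (u v : ufun R X) x : continuous2 p' -> continuous v ->
    linearized_op p' nu (t ^+ 2 *: u) (t ^+ 2 *: v) x = t ^+ 2 * linearized_op p' nu u v x.
  move=> p'c vc; rewrite /linearized_op mulrDr; congr (_ + _).
  have c1 : continuous (fun y => p' x y * v y).
    by apply: continuous_mul => //; exact: continuous2_section.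
  rewrite -integralZ_continuous//; apply: eq_Rintegral => y _.
  by rewrite mulrCA.
have S : approx_second (t *: g) (t ^+ 2 *: D2 g) 0.
  have [q1c q2c qo S1 S2] := D2_solves tg; split.
  - exact: continuous_scale.
  - exact: continuous_scale.
  - by have -> : (t ^+ 2 *: D2 g).1 x1o = t ^+ 2 * (D2 g).1 x1o by []; rewrite qo.
  - move=> x; rewrite scaleS//; last exact: density_continuous2.
    rewrite /rhs1 D1E (second_orderZ _ _ _ L2 pB C1 C2) -mulrBr normrM.
    by rewrite mulr_ge0_le0// S1.
  - move=> x; rewrite scaleS//; last exact: densityT_continuous2.
    rewrite /rhs2 D1E (second_orderZ _ _ _ L1 pTB C2 C1) -mulrBr normrM.
    by rewrite mulr_ge0_le0// S2.
have [|| h1 h2] := approx_close d0 pd (D2_solves ttg) S (eta := 0).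
- by move=> x; rewrite subrr normr0.
- by move=> x; rewrite subrr normr0.
rewrite !addr0 mulr0 in h1 h2.
rewrite [LHS]surjective_pairing [RHS]surjective_pairing; congr pair; apply/funext => x.
  by apply/eqP; rewrite -subr_eq0 -normr_le0.
by apply/eqP; rewrite -subr_eq0 -normr_le0.
Qed.

End SecondDerivative.

Theorem theorem4 (R : realType) (d : nat) (eps : R) (heps : 0 < eps)
  (c : 'rV[R]_d -> 'rV[R]_d -> R)
  (c_ge0 : forall x y, 0 <= c x y)
  (c_sym : forall x y, c x y = c y x)
  (c_smooth : smooth (fun z : 'rV[R]_(d + d) => c (lsubmx z) (rsubmx z)))
  (a : 'rV[R]_d) (r : {posnum R}) (x1o x2o : Xball a r)
  (phi : probability (borelX a r) R * probability (borelX a r) R ->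
         ufun R (Xball a r) * ufun R (Xball a r))
  (phiP : forall mu, is_potentials eps c x1o x2o mu (phi mu))
  (s : nat) (mu : probability (borelX a r) R * probability (borelX a r) R)
  (D1 : linf a r s * linf a r s -> ufun R (Xball a r) * ufun R (Xball a r))
  (D1P : is_hadamard_derivative s phi mu D1) :
  exists D2 : linf a r s * linf a r s ->
              ufun R (Xball a r) * ufun R (Xball a r),
    [/\ (forall g, tangent s mu g ->
          continuous ((D2 g).1 : Xball a r -> R) /\
          continuous ((D2 g).2 : Xball a r -> R)),
        {within tangent s mu, continuous D2},
        (forall (mut : R -> probability (borelX a r) R * probability (borelX a r) R)
                (g : linf a r s * linf a r s),
          admissible mu mut ->
          let gt := fun t : R => t^-1 *: (emb2 s (mut t) - emb2 s mu) in
          gt t @[t --> 0^'+] --> g ->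
          (t ^+ 2 / 2)^-1 *: (phi (mut t) - phi mu - t *: D1 (gt t))
            @[t --> 0^'+] --> D2 g) &
        (forall (t : R) (g : linf a r s * linf a r s), 0 < t ->
          tangent s mu g -> D2 (t *: g) = t ^+ 2 *: D2 g)].
Proof.
exists (D2 eps c x1o x2o phi mu D1); split.
- move=> g tg; have [q1c q2c _ _ _] := D2_solves heps c_sym c_smooth phiP D1P tg.
  by split; [exact: q1c|exact: q2c].
- exact: D2_continuous.
- by move=> mut g adm gt gl; exact: D2_limit.
- by move=> t g t0 tg; exact: D2Z.
Qed.
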